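(* $\mathcal B$ trace defines the field $(\mathbb{Q}_p,+,\times)$.
   Context: Fix a prime $p$; $\mathbb{Q}_p$ is the field of $p$-adic numbers in the language of rings. Let $K$ be a $(2^{\aleph_0})^+$-saturated elementary extension of $\mathbb{Q}_p$, $\mathrm{Val}_p : K^\times \to \Gamma$ the $p$-adic valuation (which is $K$-definable), $V$ its valuation ring, $\Gamma_\geq$ the nonnegative elements of $\Gamma$. For $a\in K$, $t\in\Gamma$ let $B(a,t)=\{a'\in K:\mathrm{Val}_p(a-a')\ge t\}$. Let $\mathbb B$ be the set of balls $B(a,t)$ with $a\in V$, $t\in\Gamma_\ge$, identified with the quotient of $V\times\Gamma_\ge$ by the $K$-definable equivalence relation $(a,t)\sim(a',t')$ iff $B(a,t)=B(a',t')$. $\mathcal B$ is the structure induced on $\mathbb B$ by $K$: domain $\mathbb B$, with a predicate for every subset of each $\mathbb B^n$ definable with parameters in $K^{\mathrm{eq}}$. ''Definable'' means definable with parameters. For structures $\mathcal M,\mathcal O$ and an injection $\tau:O\to M^m$, $\mathcal M$ trace defines $\mathcal O$ via $\tau$ if for every $n$ and every $\mathcal O$-definable $X\subseteq O^n$ there is an $\mathcal M$-definable $Y\subseteq M^{mn}$ with $X=\{(a_1,\dots,a_n)\in O^n:(\tau(a_1),\dots,\tau(a_n))\in Y\}$; $\mathcal M$ trace defines $\mathcal O$ if it does so via some injection $\tau:O\to M^m$ for some $m$. *)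

(* Defs.v *)
From HB Require Import structures.
From mathcomp Require Import all_boot all_order all_algebra.
Set Implicit Arguments. Unset Strict Implicit. Unset Printing Implicit Defensive.
Import Order.TTheory GRing.Theory Num.Theory.
Local Open Scope ring_scope.

(* list membership without decidable equality *)
Fixpoint inL (A : Type) (x : A) (l : list A) : Prop :=
  match l with nil => False | y :: l' => y = x \/ inL x l' end.

Fixpoint term_map (A B : Type) (g : A -> B) (t : GRing.term A) : GRing.term B :=
  match t with
  | GRing.Var i => GRing.Var B i
  | GRing.Const x => GRing.Const (g x)
  | GRing.NatConst n => GRing.NatConst B n
  | GRing.Add t1 t2 => GRing.Add (term_map g t1) (term_map g t2)
  | GRing.Opp t1 => GRing.Opp (term_map g t1)
  | GRing.NatMul t1 n => GRing.NatMul (term_map g t1) n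
  | GRing.Mul t1 t2 => GRing.Mul (term_map g t1) (term_map g t2)
  | GRing.Inv t1 => GRing.Inv (term_map g t1)
  | GRing.Exp t1 n => GRing.Exp (term_map g t1) n
  end.

Fixpoint form_map (A B : Type) (g : A -> B) (f : GRing.formula A) : GRing.formula B :=
  match f with
  | GRing.Bool b => GRing.Bool b
  | GRing.Equal t1 t2 => GRing.Equal (term_map g t1) (term_map g t2)
  | GRing.Unit t1 => GRing.Unit (term_map g t1)
  | GRing.And f1 f2 => GRing.And (form_map g f1) (form_map g f2)
  | GRing.Or f1 f2 => GRing.Or (form_map g f1) (form_map g f2)
  | GRing.Implies f1 f2 => GRing.Implies (form_map g f1) (form_map g f2)
  | GRing.Not f1 => GRing.Not (form_map g f1)
  | GRing.Exists i f1 => GRing.Exists i (form_map g f1)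
  | GRing.Forall i f1 => GRing.Forall i (form_map g f1)
  end.

Fixpoint term_consts (A : Type) (t : GRing.term A) : list A :=
  match t with
  | GRing.Const x => x :: nil
  | GRing.Add t1 t2 | GRing.Mul t1 t2 => term_consts t1 ++ term_consts t2
  | GRing.Opp t1 | GRing.NatMul t1 _ | GRing.Inv t1 | GRing.Exp t1 _ => term_consts t1
  | _ => nil
  end.

Fixpoint form_consts (A : Type) (f : GRing.formula A) : list A :=
  match f with
  | GRing.Bool _ => nil
  | GRing.Equal t1 t2 => term_consts t1 ++ term_consts t2
  | GRing.Unit t1 => term_consts t1
  | GRing.And f1 f2 | GRing.Or f1 f2 | GRing.Implies f1 f2 =>
      form_consts f1 ++ form_consts f2
  | GRing.Not f1 | GRing.Exists _ f1 | GRing.Forall _ f1 => form_consts f1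
  end.

Definition padic_val_rat (p : nat) (q : rat) : int :=
  (logn p `|numq q|%N)%:Z - (logn p `|denq q|%N)%:Z.

(* (F, v) is Q_p: a field of characteristic 0 with a valuation v : F^x -> Z
   extending the p-adic valuation of Q, in which Q is dense and which is complete.
   (The value v 0 is irrelevant.) *)
Definition is_Qp (p : nat) (F : fieldType) (v : F -> int) : Prop :=
  [pchar F] =i pred0 /\
  [/\ (forall x y : F, x != 0 -> y != 0 -> v (x * y) = v x + v y),
      (forall x y : F, x != 0 -> y != 0 -> x + y != 0 -> Num.min (v x) (v y) <= v (x + y)),
      (forall q : rat, q != 0 -> v (ratr q) = padic_val_rat p q),
      (forall (x : F) (n : int), exists q : rat, x = ratr q \/ n <= v (x - ratr q)) &
      (forall u : nat -> F,
         (forall n : int, exists N : nat, forall i j : nat, (N <= i)%N -> (N <= j)%N ->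
              u i = u j \/ n <= v (u i - u j)) ->
         exists l : F, forall n : int, exists N : nat, forall i : nat, (N <= i)%N ->
              u i = l \/ n <= v (u i - l))].

Definition elementary (F K : fieldType) (iota : F -> K) : Prop :=
  forall (f : GRing.formula F) (e : seq F),
    GRing.holds e f <-> GRing.holds (map iota e) (form_map iota f).

(* (2^aleph_0)^+-saturation: every finitely satisfiable 1-type over a parameter
   set A of cardinality <= 2^aleph_0 (i.e. injecting into nat -> bool) is realized.
   Formulas are in the free variable 'X_0 (evaluated in the environment [:: x]). *)
Definition continuum_plus_saturated (K : fieldType) : Prop :=
  forall (A : K -> Prop) (Sigma : GRing.formula K -> Prop),
    (exists g : K -> (nat -> bool), forall x y, A x -> A y -> g x = g y -> x = y) ->
    (forall f, Sigma f -> forall c, inL c (form_consts f) -> A c) ->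
    (forall s : seq (GRing.formula K), (forall f, inL f s -> Sigma f) ->
        exists x : K, forall f, inL f s -> GRing.holds [:: x] f) ->
    exists x : K, forall f, Sigma f -> GRing.holds [:: x] f.

Section Balls.
Variable K : fieldType.
Variable V : K -> Prop.   (* the valuation ring of K *)

(* B(a, Val_p c) = {a' : Val_p(a - a') >= Val_p c} = a + c V  (c <> 0) *)
Definition ball (a c : K) : K -> Prop := fun y => exists d, V d /\ y = a + c * d.

(* the set of balls B(a,t), a in V, t in Gamma_{>=0}, i.e. t = Val_p c, c in V \ {0} *)
Definition Ball : Type :=
  {B : K -> Prop | exists a c, [/\ V a, V c, c != 0 & B = ball a c]}.

Definition ball_env (I : finType) (a c : I -> K) : seq K :=
  flatten [seq [:: a i; c i] | i <- enum I].

(* Y subset of Ball^I is definable in K^eq: its preimage in (V x (V\{0}))^I is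
   K-definable with parameters *)
Definition B_definable (I : finType) (Y : (I -> Ball) -> Prop) : Prop :=
  exists psi : GRing.formula K,
    forall (a c : I -> K) (b : I -> Ball),
      (forall i, [/\ V (a i), V (c i), c i != 0 & proj1_sig (b i) = ball (a i) (c i)]) ->
      (Y b <-> GRing.holds (ball_env a c) psi).

End Balls.

Definition field_definable (F : fieldType) (n : nat) (X : ('I_n -> F) -> Prop) : Prop :=
  exists f : GRing.formula F, forall x : 'I_n -> F,
    X x <-> GRing.holds [seq x i | i <- enum 'I_n] f.

Arguments is_Qp : clear implicits.
Definition ball_trace_defines_field (K : fieldType) (V : K -> Prop) (F : fieldType) : Prop :=
  exists (m : nat) (tau : F -> ('I_m -> Ball V)),
    injective tau /\
    forall (n : nat) (X : ('I_n -> F) -> Prop), field_definable X ->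
      exists Y : ('I_n * 'I_m -> Ball V) -> Prop,
        B_definable Y /\ forall x : 'I_n -> F, X x <-> Y (fun ij => tau (x ij.1) ij.2).

(* Main.v *)
Require Import Defs.
From HB Require Import structures.
From mathcomp Require Import all_boot all_order all_algebra.
From mathcomp Require Import ring zify boolp classical_sets.
Import Order.TTheory GRing.Theory Num.Theory.
Local Open Scope ring_scope.

(** Coarsening the valuation of [K] by the standard convex subgroup [Z] of its value group
    gives a henselian valuation of residue characteristic 0, trivial on [Q_p].  Say that two
    tuples of [K] are equivalent if some partial field isomorphism over [Q_p] sends one to the
    other and moves every element by a factor infinitely close to 1.  A back-and-forth
    argument, resting on Hensel's lemma and on the existence of good centers for polynomials,
    shows that formulas over [Q_p] are invariant under this equivalence.  By compactness each
    formula [f] is then governed by finitely many polynomials [Q_j]: its truth at [a] depends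
    only on the classes of the [Q_j(a)] modulo [1 + p^N V], up to which of them vanish.

    Fix [c <> 0] in [K] with valuation above [Z] and send [x] in [Q_p] to the ball
    [c x + c^2 V].  The points [y] with [c y] in this ball are infinitely close to [x], so
    [Q_j(x) = 0] iff [Q_j] has a zero near [x], and [f(x)] holds iff [f] holds at some nearby
    [y] such that every [Q_j] either vanishes at [y] or has no zero near [x].  This condition
    involves only the balls. *)

Set Implicit Arguments. Unset Strict Implicit. Unset Printing Implicit Defensive.

(** A ball fixes a point of Q_p only up to infinitesimals, and the truth of a formula can jump
    inside such a neighbourhood. There is a single cause: a nonzero value Q_j(x) is a unit of the
    coarse valuation, so Q_j keeps its leading term at all nearby points. Only vanishing at x can
    get lost, and it is recovered from a zero near x because 0 is the only infinitesimal of Q_p. The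
    factor c brings every center into the valuation ring, even when x has negative valuation, and
    the radius of c^2 is still infinitesimal after division by c. Equations alone would only ask for
    partial isomorphisms. Requiring leading terms to be fixed is what makes one-point extensions
    possible, with no separate treatment of residue field and value group, which are not moved. The
    coarsening is needed because the search for centers differentiates polynomials: the binomial
    coefficients that appear must be units, while p divides some of them. An extension is built for
    finitely many polynomials at a time, and saturation passes to all of them. *)

(** * Henselian valuations of residue characteristic 0 *)

(** The valuation is given by its ring and maximal ideal, without a value group. [valOnatV]
    expresses residue characteristic 0, and Hensel's lemma is stated at the residue class of 0. *)
Record henselian_char0 (K : fieldType) (O m : K -> Prop) : Prop := HenselianChar0 {
  valO1 : O 1;
  valOB : forall x y, O x -> O y -> O (x - y);
  valOM : forall x y, O x -> O y -> O (x * y);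
  valm0 : m 0;
  valmO : forall x, m x -> O x;
  valmD : forall x y, m x -> m y -> m (x + y);
  valmM : forall x y, O x -> m y -> m (x * y);
  valOVm : forall x, x != 0 -> O x \/ m x^-1;
  valm1 : ~ m 1;
  valnat : forall n, n.+1%:R != 0 :> K;
  valOnatV : forall n, O (n.+1%:R)^-1;
  val_hensel : forall f : {poly K}, (forall i, O f`_i) -> m f`_0 -> ~ m f`_1 ->
    exists2 s, m s & f.[s] = 0 }.

Section HenselianChar0.
Variables (K : fieldType) (O m : K -> Prop).
Hypothesis HO : henselian_char0 O m.

Let O1 := valO1 HO. Let OB := valOB HO. Let OM := valOM HO. Let mO := valmO HO.
Let m0 := valm0 HO. Let mD := valmD HO. Let mM := valmM HO. Let m1 := valm1 HO.

Lemma valO0 : O 0. Proof. by rewrite -(subrr 1); apply: OB. Qed.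
Lemma valON x : O x -> O (- x).
Proof. by move=> Ox; rewrite -sub0r; apply: OB => //; apply: valO0. Qed.
Lemma valOD x y : O x -> O y -> O (x + y).
Proof. by move=> Ox Oy; rewrite -[y]opprK; apply: OB => //; apply: valON. Qed.
Lemma valOX x n : O x -> O (x ^+ n).
Proof. by move=> Ox; elim: n => [|n IH]; rewrite ?expr0 // exprS; apply: OM. Qed.
Lemma valOnat n : O n%:R.
Proof. by elim: n => [|n IH]; [apply: valO0 | rewrite -natr1; apply: valOD]. Qed.
Lemma valmN x : m x -> m (- x).
Proof. by move=> mx; rewrite -mulN1r; apply: mM => //; apply: valON. Qed.

Lemma val_unit_neq0 x : ~ m x -> x != 0.
Proof. by move=> nmx; apply/eqP=> x0; apply: nmx; rewrite x0. Qed.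

Lemma val_unitV x : ~ m x -> O x^-1.
Proof.
move=> nmx; have x0 := val_unit_neq0 nmx.
by case: (valOVm HO (invr_neq0 x0)) => //; rewrite invrK.
Qed.

Lemma val_unit_not_m x : x != 0 -> O x^-1 -> ~ m x.
Proof. by move=> x0 Oxi mx; apply: m1; rewrite -(mulVf x0); apply: mM. Qed.

Lemma val_1Dm_unit x : m x -> ~ m (1 + x).
Proof. by move=> mx m1x; apply: m1; rewrite -(addrK x 1); apply: mD => //; apply: valmN. Qed.

(* [a ≼ b], [a ≺ b] for the valuation; [approx a b] says that [a] and [b] have the same
   leading term, that is, the same image in [K^* / (1 + m)]. *)
Definition dom a b := exists2 x, O x & a = x * b.
Definition sdom a b := exists2 x, m x & a = x * b.
Definition approx a b := sdom (a - b) b.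

Lemma dom_refl a : dom a a. Proof. by exists 1; rewrite ?mul1r. Qed.
Lemma dom_trans b a c : dom a b -> dom b c -> dom a c.
Proof. by move=> [x Ox ->] [y Oy ->]; exists (x * y); rewrite ?mulrA //; apply: OM. Qed.
Lemma dom0 a : dom 0 a. Proof. by exists 0; rewrite ?mul0r //; apply: valO0. Qed.
Lemma domD a b c : dom a c -> dom b c -> dom (a + b) c.
Proof. by move=> [x Ox ->] [y Oy ->]; exists (x + y); rewrite ?mulrDl //; apply: valOD. Qed.
Lemma domN a c : dom a c -> dom (- a) c.
Proof. by move=> [x Ox ->]; exists (- x); rewrite ?mulNr //; apply: valON. Qed.
Lemma domB a b c : dom a c -> dom b c -> dom (a - b) c.
Proof. by move=> ac bc; apply: domD => //; apply: domN. Qed.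
Lemma domMl x a b : O x -> dom a b -> dom (x * a) b.
Proof. by move=> Ox [y Oy ->]; exists (x * y); [apply: OM | ring]. Qed.
Lemma dom_sum (I : Type) (r : seq I) (P : pred I) (f : I -> K) c :
  (forall i, P i -> dom (f i) c) -> dom (\sum_(i <- r | P i) f i) c.
Proof.
move=> H; elim/big_rec: _ => [|i x Pi dx]; first exact: dom0.
by apply: domD => //; apply: H.
Qed.

Lemma sdom_dom a b : sdom a b -> dom a b.
Proof. by move=> [x mx ->]; exists x => //; apply: mO. Qed.
Lemma sdom_trans_dom b a c : sdom a b -> dom b c -> sdom a c.
Proof. by move=> [x mx ->] [y Oy ->]; exists (y * x); [apply: mM | ring]. Qed.
Lemma dom_trans_sdom b a c : dom a b -> sdom b c -> sdom a c.
Proof. by move=> [x mx ->] [y Oy ->]; exists (x * y); [apply: mM | ring]. Qed.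
Lemma sdom0 a : sdom 0 a. Proof. by exists 0; rewrite ?mul0r. Qed.
Lemma sdomD a b c : sdom a c -> sdom b c -> sdom (a + b) c.
Proof. by move=> [x Ox ->] [y Oy ->]; exists (x + y); rewrite ?mulrDl //; apply: mD. Qed.
Lemma sdomN a c : sdom a c -> sdom (- a) c.
Proof. by move=> [x Ox ->]; exists (- x); rewrite ?mulNr //; apply: valmN. Qed.
Lemma sdomMr a b c d : sdom a b -> dom c d -> sdom (a * c) (b * d).
Proof. by move=> [x Ox ->] [y Oy ->]; exists (y * x); [apply: mM | ring]. Qed.
Lemma sdomMl a b c d : dom a b -> sdom c d -> sdom (a * c) (b * d).
Proof. by move=> ab cd; rewrite mulrC (mulrC b); apply: sdomMr. Qed.
Lemma sdom_sum (I : Type) (r : seq I) (P : pred I) (f : I -> K) c :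
  (forall i, P i -> sdom (f i) c) -> sdom (\sum_(i <- r | P i) f i) c.
Proof.
move=> H; elim/big_rec: _ => [|i x Pi dx]; first exact: sdom0.
by apply: sdomD => //; apply: H.
Qed.
Lemma dom_total a b : dom a b \/ sdom b a.
Proof.
have [->|a0] := eqVneq a 0; first by left; apply: dom0.
have [->|b0] := eqVneq b 0; first by right; apply: sdom0.
case: (valOVm HO (mulf_neq0 a0 (invr_neq0 b0))) => [ab|ab]; [left|right].
  by exists (a / b); rewrite ?divfK.
by exists (a / b)^-1; rewrite // invfM invrK mulrAC mulVf ?mul1r.
Qed.
Lemma sdom_dom_eq0 a b : sdom a b -> dom b a -> b = 0.
Proof.
move=> [x mx ->] [y Oy E]; apply/eqP; apply/negP=> /negP b0.
apply: m1; have -> : 1 = y * x; last exact: mM.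
by apply: (mulIf b0); rewrite mul1r -mulrA.
Qed.

Lemma approx_refl a : approx a a. Proof. by rewrite /approx subrr; apply: sdom0. Qed.
Lemma approxP a b : approx a b -> exists2 x, m x & a = (1 + x) * b.
Proof. by move=> [x mx E]; exists x => //; rewrite mulrDl mul1r -E; ring. Qed.
Lemma approx_dom_r a b : approx a b -> dom b a.
Proof.
move=> /approxP [x mx ->]; have u := val_1Dm_unit mx.
exists (1 + x)^-1; first exact: val_unitV.
by rewrite mulKf //; apply: val_unit_neq0.
Qed.
Lemma approx_dom_l a b : approx a b -> dom a b.
Proof. by move=> /approxP [x mx ->]; exists (1 + x) => //; apply: valOD => //; apply: mO. Qed.
Lemma approx_sym a b : approx a b -> approx b a.
Proof.
move=> ab; rewrite /approx -opprB; apply: sdomN; apply: (sdom_trans_dom ab).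
exact: approx_dom_r.
Qed.
Lemma approxM a b c d : approx a b -> approx c d -> approx (a * c) (b * d).
Proof.
move=> ab cd; rewrite /approx.
have -> : a * c - b * d = (a - b) * c + b * (c - d) by ring.
apply: sdomD; first by apply: sdomMr => //; apply: approx_dom_l.
by apply: sdomMl => //; apply: dom_refl.
Qed.
Lemma approxX a b n : approx a b -> approx (a ^+ n) (b ^+ n).
Proof.
by move=> ab; elim: n => [|n IH]; [apply: approx_refl | rewrite !exprS; apply: approxM].
Qed.
Lemma approx_eq0 a b : approx a b -> (a = 0) <-> (b = 0).
Proof.
move=> ab; split=> E; [have := approx_dom_r ab | have := approx_dom_l ab];
by rewrite E => -[x _ ->]; rewrite mulr0.
Qed.
Lemma approxV a b : approx a b -> approx a^-1 b^-1.
Proof.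
move=> ab; have [b0|b0] := eqVneq b 0.
  by move/approx_eq0: (ab) => /iffRL /(_ b0) ->; rewrite b0; apply: approx_refl.
have a0 : a != 0 by apply: contra_neq b0 => /(iffLR (approx_eq0 ab)).
have {ab} [x mx E] := approx_sym ab.
exists x => //; rewrite -[RHS]/(x / b).
have -> : x = (b - a) / a by rewrite E mulfK.
by field; rewrite a0 b0.
Qed.

(** Dividing f(s) - f(t) by s - t leaves the linear coefficient plus an element of [m], hence
    something nonzero. *)
Lemma hensel_unique (f : {poly K}) s t : (forall i, O f`_i) -> ~ m f`_1 ->
  m s -> m t -> f.[s] = 0 -> f.[t] = 0 -> s = t.
Proof.
move=> Of nm1 ms mt fs ft; apply/eqP; rewrite -subr_eq0; apply/negP=> /negP st.
have key n : exists2 x, m x & \sum_(i < n.+2) f`_i * (s ^+ i - t ^+ i)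
    = (s - t) * (f`_1 + x).
  elim: n => [|n [x mx IH]].
    exists 0 => //; rewrite !big_ord_recr big_ord0 /= !expr0 !expr1; ring.
  rewrite big_ord_recr /= IH subrXX.
  exists (x + f`_n.+2 * (\sum_(i < n.+2) s ^+ (n.+2.-1 - i) * t ^+ i)); last by ring.
  apply: mD => //; apply: mM => //; elim/big_rec: _ => // i y _ my.
  apply: mD => //; case: (ltnP 0 i) => [i0|].
    case: (nat_of_ord i) i0 => // j _; rewrite exprS mulrCA mulrC.
    by apply: mM => //; apply: OM; apply: valOX; apply: mO.
  rewrite leqn0 => /eqP->; rewrite subn0 expr0 mulr1 /= exprS mulrC.
  by apply: mM => //; apply: valOX; apply: mO.
have [x mx E] := key (size f).
have : (s - t) * (f`_1 + x) = 0.
  rewrite -E; under eq_bigr do rewrite mulrBr.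
  by rewrite sumrB -!horner_coef_wide ?fs ?ft ?subr0 //; apply: leqW; apply: leqW.
move/eqP; rewrite mulf_eq0 (negPf st) /= => /eqP E2.
apply: nm1; have -> : f`_1 = - x by apply/eqP; rewrite -addr_eq0 E2.
exact: valmN.
Qed.

(** * Taylor expansions and good centers *)

(** The factor [w] is the binomial coefficient of i + j over i, a unit of [O] because the residue
    characteristic is 0. So Taylor coefficients of a derivative of [Q] have the same size as those
    of [Q]. *)
Lemma nderivn_nderivn (Q : {poly K}) i j : exists w, [/\ O w, O w^-1, w != 0 &
  forall x, Q^`N(i)^`N(j).[x] = w * Q^`N(i + j).[x]].
Proof.
have f0 n : n`!%:R != 0 :> K by case: n`! (fact_gt0 n) => // k _; apply: (valnat HO).
have fO n : O n`!%:R by apply: valOnat.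
have fV n : O (n`!%:R)^-1 by case: n`! (fact_gt0 n) => // k _; apply: (valOnatV HO).
exists ((i + j)`!%:R / (i`!%:R * j`!%:R)); split.
- by rewrite invfM; apply: OM => //; apply: OM.
- by rewrite invfM invrK; apply: OM => //; apply: OM.
- by rewrite mulf_neq0 ?invr_eq0 ?mulf_neq0.
move=> x; apply: (mulfI (mulf_neq0 (f0 i) (f0 j))).
rewrite mulrA [_ * (_ / _)]mulrC divfK ?mulf_neq0 //.
have E : Q^`(i + j) = Q^`(i)^`(j) by rewrite addnC /derivn iterD.
rewrite -natrM !mulr_natl -!hornerMn -nderivn_def E (nderivn_def j) (nderivn_def i).
by rewrite nderivnMn -mulrnA.
Qed.

Lemma taylor_wide (Q : {poly K}) n x h : (size Q <= n)%N ->
  Q.[x + h] = \sum_(i < n) Q^`N(i).[x] * h ^+ i.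
Proof. by move=> sQ; apply: (nderiv_taylor_wide _ sQ); apply: mulrC. Qed.


Lemma dominant_index (a : nat -> K) n :
  exists2 k, (k <= n)%N & forall j, (j <= n)%N -> dom (a j) (a k).
Proof.
elim: n => [|n [k kn IH]].
  by exists 0%N => // j; rewrite leqn0 => /eqP->; apply: dom_refl.
have [d|/sdom_dom d] := dom_total (a n.+1) (a k); [exists k | exists n.+1] => //.
- by rewrite ltnW.
- by move=> j; rewrite leq_eqVlt => /orP[/eqP->//|]; apply: IH.
- move=> j; rewrite leq_eqVlt => /orP[/eqP->|/IH jn]; first exact: dom_refl.
  exact: dom_trans jn d.
Qed.

Lemma lead_nderivn (Q : {poly K}) x : Q != 0 -> Q^`N((size Q).-1).[x] != 0.
Proof.
move=> Q0; set n := (size Q).-1.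
have sz : (0 < size Q)%N by rewrite size_poly_gt0.
have -> : Q^`N(n) = (lead_coef Q)%:P.
  apply/polyP=> i; rewrite coef_nderivn coefC; case: i => [|i].
    by rewrite addn0 binn mulr1n.
  by rewrite nth_default ?mul0rn // /n; case: (size Q) sz => //= k _; rewrite addnS ltnS leq_addr.
by rewrite hornerC lead_coef_eq0.
Qed.

Lemma size_nderivn (Q : {poly K}) n : (size Q^`N(n) <= size Q - n)%N.
Proof. exact: size_poly. Qed.

(* Newton polygon step: if [z^(nu+1)] carries the first dominant Taylor term of [Q] at
   [gamma], then Hensel's lemma finds a root of the [nu]-th derivative closer to [gamma]
   than [z], and seen from there the term of index [nu] dominates that of index [nu+1];
   this uses that [nu+1] is a unit. *)
Lemma center_step (Q : {poly K}) (x z : K) (nu : nat) :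
  z != 0 -> Q^`N(nu.+1).[x] != 0 ->
  (forall k, dom (Q^`N(k).[x] * z ^+ k) (Q^`N(nu.+1).[x] * z ^+ nu.+1)) ->
  sdom (Q^`N(nu).[x] * z ^+ nu) (Q^`N(nu.+1).[x] * z ^+ nu.+1) ->
  exists2 z', Q^`N(nu).[x - z'] = 0 &
    forall k, (nu <= k)%N -> dom (Q^`N(k).[x] * z' ^+ k) (Q^`N(nu).[x] * z' ^+ nu).
Proof.
move=> z0 g0 D S; pose g k := Q^`N(k).[x]; pose n := (size Q).+2.
pose H := Q^`N(nu); pose c := g nu.+1 * z.
have c0 : c != 0 by rewrite mulf_neq0.
(* This is H(x + z s) / c as a polynomial in s. Domination puts its coefficients in [O], strict
   domination puts the constant one in [m], and division by [c] leaves a binomial coefficient as the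
   linear one. *)
pose f := \poly_(i < n) (H^`N(i).[x] * z ^+ i / c).
have sH : (size H <= n)%N.
  by apply: leq_trans (size_nderivn _ _) _; rewrite /n (leq_trans (leq_subr _ _)) // -addn2 leq_addr.
have coefE i : exists w, [/\ O w, O w^-1, w != 0 & H^`N(i).[x] = w * g (nu + i)%N].
  by have [w [? ? ? E]] := nderivn_nderivn Q nu i; exists w.
have coefD i : exists2 y, O y & H^`N(i).[x] * z ^+ i = y * c.
  have [w [Ow _ _ ->]] := coefE i; have [y Oy E] := D (nu + i)%N.
  exists (w * y); first exact: OM.
  apply: (mulIf (expf_neq0 nu z0)).
  have -> : w * g (nu + i)%N * z ^+ i * z ^+ nu = w * (g (nu + i)%N * z ^+ (nu + i)) by rewrite exprD; ring.
  by rewrite E /c /g exprS; ring.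
have [|||u mu fu] := val_hensel HO (f := f).
- move=> i; rewrite coef_poly; case: ifP => _; last exact: valO0.
  by have [y Oy ->] := coefD i; rewrite mulfK.
- rewrite coef_poly /= expr0 mulr1 nderivn0.
  have [y my E] := S; suff -> : H.[x] / c = y by [].
  apply: (mulIf c0); rewrite divfK //; apply: (mulIf (expf_neq0 nu z0)).
  by rewrite E /c /g exprS; ring.
- rewrite coef_poly /= expr1; have [w [Ow OVw w0 ->]] := coefE 1%N.
  rewrite addn1 -[w * _ * _]mulrA -/c mulfK //; exact: val_unit_not_m.
pose z' := - (z * u).
have Hz : H.[x - z'] = 0.
  apply: (mulIf (invr_neq0 c0)); rewrite mul0r -fu [RHS]horner_poly /z' opprK (taylor_wide _ _ sH) mulr_suml.
  by apply: eq_bigr => i _; rewrite exprMn; ring.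
have D1 k : dom (g (nu.+1 + k)%N * z' ^+ (nu.+1 + k)) (u ^+ k * (g nu.+1 * z' ^+ nu.+1)).
  have [y Oy E] : dom (g (nu.+1 + k)%N * z ^+ (nu.+1 + k)) (g nu.+1 * z ^+ nu.+1) := D _.
  have -> : g (nu.+1 + k)%N * z' ^+ (nu.+1 + k) = (y * (-1) ^+ k) * (u ^+ k * (g nu.+1 * z' ^+ nu.+1)).
    have -> : z' = z * - u by rewrite mulrN.
    rewrite exprMn [LHS]mulrA E exprMn exprD.
    by rewrite [(- u) ^+ k]exprNn; ring.
  exists (y * (-1) ^+ k) => //; apply: OM => //; apply: valOX; apply: valON; exact: O1.
have D2 k : dom (g (nu.+1 + k)%N * z' ^+ (nu.+1 + k)) (g nu.+1 * z' ^+ nu.+1).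
  apply: dom_trans (D1 k) _; apply: domMl (dom_refl _); apply: valOX; exact: mO.
(* Solve H(x - z') = 0 for its linear term. The terms of higher order carry extra factors [u] in
   [m]; if the term of index [nu] were strictly smaller too, the linear term would be strictly
   smaller than itself, hence zero. *)
have D3 : dom (g nu.+1 * z' ^+ nu.+1) (g nu * z' ^+ nu).
  have [//|S'] := dom_total (g nu.+1 * z' ^+ nu.+1) (g nu * z' ^+ nu).
  suff -> : g nu.+1 * z' ^+ nu.+1 = 0 by apply: dom0.
  apply: (sdom_dom_eq0 (a := g nu.+1 * z' ^+ nu.+1)); last exact: dom_refl.
  have [w [Ow OVw w0 E1]] := coefE 1%N; rewrite addn1 in E1.
  have {}Hz : H.[x - z'] * z' ^+ nu = 0 by rewrite Hz mul0r.
  move: Hz; rewrite (taylor_wide _ _ sH) /n !big_ord_recl /= !expr0 expr1 mulr1 nderivn0 E1.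
  set R := \sum_(i < _) _ => Hz.
  have E2 : g nu.+1 * z' ^+ nu.+1 = w^-1 * (g nu * z' ^+ nu + R * z' ^+ nu).
    apply: (mulfI w0); rewrite mulVKf //; apply/eqP; rewrite -subr_eq0 -oppr_eq0; apply/eqP.
    by rewrite -[RHS]Hz /H -/(g nu) exprS; ring.
  apply: (dom_trans_sdom (b := g nu * z' ^+ nu + R * z' ^+ nu)).
    by rewrite [X in dom X _]E2; exact: domMl (dom_refl _).
  apply: sdomD => //; rewrite /R mulr_suml; apply: sdom_sum => i _.
  rewrite /bump /= !add1n; have [wi [Owi _ _ ->]] := coefE i.+2.
  apply: (dom_trans_sdom (b := g (nu.+1 + i.+1)%N * z' ^+ (nu.+1 + i.+1))).
    exists (wi * (-1) ^+ i.+2); first by apply: OM => //; apply: valOX; apply: valON; exact: O1.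
    by rewrite [(- z') ^+ _]exprNn addSnnS exprD; ring.
  apply: (dom_trans_sdom (D1 _)); exists (u ^+ i * u); first by apply: mM => //; apply: valOX; exact: mO.
  by rewrite -exprSr.
exists z' => // k; rewrite leq_eqVlt => /orP[/eqP<-|]; first exact: dom_refl.
by move=> /subnKC <-; apply: dom_trans (D2 _) D3.
Qed.

(** Descent on the dominant index, starting from the center 0. While the index exceeds [lo], either
    the preceding term is as large, or [center_step] provides a root of a derivative, which lies in
    [E] and is a center with a smaller dominant index. The value [lo = 1] serves polynomials
    vanishing at [x], whose term of index 0 is zero; [lo = 0] serves the others. *)
Lemma center_exists (E : K -> Prop) (Q : {poly K}) (x : K) (lo : nat) :
  Q != 0 -> ~ E x -> E 0 ->
  (forall nu y, (lo <= nu)%N -> Q^`N(nu) != 0 -> Q^`N(nu).[y] = 0 -> E y) ->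
  exists e, E e /\ exists2 mu, (mu <= lo)%N &
    forall k, dom (Q^`N(k).[x] * (x - e) ^+ k) (Q^`N(mu).[x] * (x - e) ^+ mu).
Proof.
move=> Q0 nEx E0 HE; pose g k := Q^`N(k).[x].
have xe e : E e -> x - e != 0.
  by move=> Ee; rewrite subr_eq0; apply/eqP=> xe; apply: nEx; rewrite xe.
have main mu e : E e -> (forall k, dom (g k * (x - e) ^+ k) (g mu * (x - e) ^+ mu)) ->
    exists e, E e /\ exists2 mu, (mu <= lo)%N &
      forall k, dom (g k * (x - e) ^+ k) (g mu * (x - e) ^+ mu).
  elim/ltn_ind: mu e => mu IH e Ee D.
  have [mlo|lom] := leqP mu lo; first by exists e; split => //; exists mu.
  case: mu IH D lom => // nu IH D lom.
  have [d|S] := dom_total (g nu.+1 * (x - e) ^+ nu.+1) (g nu * (x - e) ^+ nu).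
    by apply: (IH nu _ e) => // k; apply: dom_trans (D k) d.
  have gnu : g nu.+1 != 0.
    apply: contraNneq (lead_nderivn x Q0) => gz.
    have [y _] := D (size Q).-1; rewrite gz mul0r mulr0 => /eqP.
    by rewrite mulf_eq0 expf_eq0 (negPf (xe _ Ee)) andbF orbF.
  have [z' root_z' D'] := center_step (xe _ Ee) gnu D S.
  have Ee' : E (x - z').
    apply: (HE nu) => //.
    apply: contraNneq gnu => H0; have [w [_ _ w0 /(_ x) E1]] := nderivn_nderivn Q nu 1.
    move: E1; rewrite H0 linear0 horner0 addn1 => /esym/eqP.
    by rewrite mulf_eq0 (negPf w0).
  have zE : x - (x - z') = z' by ring.
  have [k kn Dk] := dominant_index (fun k => g k * z' ^+ k) nu.
  apply: (IH k _ (x - z')) => //; rewrite zE => j.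
  have [jn|/ltnW nj] := leqP j nu; first exact: Dk.
  exact: dom_trans (D' _ nj) (Dk _ _).
have [k kn Dk] := dominant_index (fun k => g k * (x - 0) ^+ k) (size Q).
apply: (main k 0 E0) => j; have [jn|/ltnW nj] := leqP j (size Q); first exact: Dk.
by rewrite /g nderivn_poly0 // horner0 mul0r; apply: dom0.
Qed.

(** * Partial isomorphisms preserving leading terms *)

(* A partial isomorphism between subrings of [K] preserving leading terms, given by its
   graph; being a function and injective follows from [good_approx]. *)
Record good (G : K -> K -> Prop) : Prop := Good {
  good1 : G 1 1;
  goodB : forall a b c d, G a b -> G c d -> G (a - c) (b - d);
  goodM : forall a b c d, G a b -> G c d -> G (a * c) (b * d);
  good_approx : forall a b, G a b -> approx b a }.

Definition polyrel (G : K -> K -> Prop) (P P' : {poly K}) := forall i, G P`_i P'`_i.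

Section Good.
Variable G : K -> K -> Prop.
Hypothesis gG : good G.

Lemma good0 : G 0 0.
Proof. by rewrite -(subrr 1); apply: goodB => //; apply: good1. Qed.
Lemma goodN a b : G a b -> G (- a) (- b).
Proof. by move=> ab; rewrite -sub0r -(sub0r b); apply: goodB => //; apply: good0. Qed.
Lemma goodD a b c d : G a b -> G c d -> G (a + c) (b + d).
Proof. by move=> ab cd; rewrite -[c]opprK -[d]opprK; apply: goodB => //; apply: goodN. Qed.
Lemma goodX a b n : G a b -> G (a ^+ n) (b ^+ n).
Proof.
by move=> ab; elim: n => [|n IH]; [apply: good1 | rewrite !exprS; apply: goodM].
Qed.
Lemma goodMn a b n : G a b -> G (a *+ n) (b *+ n).
Proof.
by move=> ab; elim: n => [|n IH]; [apply: good0 | rewrite !mulrS; apply: goodD].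
Qed.
Lemma good_sum (I : Type) (r : seq I) (P : pred I) (f h : I -> K) :
  (forall i, P i -> G (f i) (h i)) -> G (\sum_(i <- r | P i) f i) (\sum_(i <- r | P i) h i).
Proof. by move=> H; elim/big_rec2: _ => [|i a b Pi]; [apply: good0 | apply: goodD; apply: H]. Qed.
Lemma good_eq0 a b : G a b -> (a == 0) = (b == 0).
Proof.
by move=> /(good_approx gG)/approx_eq0 ab; apply/eqP/eqP=> H; apply/ab.
Qed.

Lemma polyrel_size P P' : polyrel G P P' -> size P = size P'.
Proof.
move=> PP; apply/eqP; rewrite eqn_leq; apply/andP; split; apply/leq_sizeP => j js; apply/eqP.
  by rewrite (good_eq0 (PP j)) nth_default.
by rewrite -(good_eq0 (PP j)) nth_default.
Qed.
Lemma polyrel_horner P P' a b : polyrel G P P' -> G a b -> G P.[a] P'.[b].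
Proof.
move=> PP ab; rewrite !horner_coef (polyrel_size PP).
by apply: good_sum => i _; apply: goodM => //; apply: goodX.
Qed.
Lemma polyrel_nderivn P P' n : polyrel G P P' -> polyrel G P^`N(n) P'^`N(n).
Proof. by move=> PP i; rewrite !coef_nderivn; apply: goodMn. Qed.
Lemma polyrelC a b : G a b -> polyrel G a%:P b%:P.
Proof. by move=> ab i; rewrite !coefC; case: ifP => // _; apply: good0. Qed.
Lemma polyrelX : polyrel G 'X 'X.
Proof. by move=> i; rewrite !coefX; case: eqP => _; [apply: good1 | apply: good0]. Qed.
Lemma polyrelB P P' Q Q' : polyrel G P P' -> polyrel G Q Q' -> polyrel G (P - Q) (P' - Q').
Proof. by move=> PP QQ i; rewrite !coefB; apply: goodB. Qed.
Lemma polyrelM P P' Q Q' : polyrel G P P' -> polyrel G Q Q' -> polyrel G (P * Q) (P' * Q').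
Proof. by move=> PP QQ i; rewrite !coefM; apply: good_sum => j _; apply: goodM. Qed.

Lemma polyrelN P P' : polyrel G P P' -> polyrel G (- P) (- P').
Proof. by move=> PP i; rewrite !coefN; apply: goodN. Qed.
Lemma polyrelD P P' Q Q' : polyrel G P P' -> polyrel G Q Q' -> polyrel G (P + Q) (P' + Q').
Proof. by move=> PP QQ i; rewrite !coefD; apply: goodD. Qed.
Lemma polyrelMn P P' n : polyrel G P P' -> polyrel G (P *+ n) (P' *+ n).
Proof. by move=> PP i; rewrite !coefMn; apply: goodMn. Qed.
Lemma polyrel_exp P P' n : polyrel G P P' -> polyrel G (P ^+ n) (P' ^+ n).
Proof.
move=> PP; elim: n => [|n IH]; first by rewrite !expr0; apply: polyrelC; apply: good1.
by rewrite !exprS; apply: polyrelM.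
Qed.

(** A point [y] adapted to a center [e1] is adapted to every center at least as far from [x]: the
    error made in replacing e1 - e by its image is small compared with x - e. *)
Lemma approx_center x y e1 e1' e e' : G e1 e1' -> G e e' ->
  approx (y - e1') (x - e1) -> dom (x - e1) (x - e) -> approx (y - e') (x - e).
Proof.
move=> G1 Ge A D; rewrite /approx.
have -> : y - e' - (x - e) = (y - e1' - (x - e1)) + ((e1' - e') - (e1 - e)) by ring.
apply: sdomD; first exact: sdom_trans_dom A D.
apply: sdom_trans_dom (good_approx gG (goodB gG G1 Ge)) _.
have -> : e1 - e = (x - e) - (x - e1) by ring.
by apply: domB => //; apply: dom_refl.
Qed.

(** Expand both polynomials at the centers: corresponding terms have the same leading term.
    Expanding again around [x] shows that each term at [e] is dominated by [c]. With c = P(x) this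
    gives P'(y) the leading term of P(x). *)
Lemma horner_transfer P P' e e' x y c : polyrel G P P' -> G e e' ->
  approx (y - e') (x - e) -> (forall k, dom (P^`N(k).[x] * (x - e) ^+ k) c) ->
  sdom (P'.[y] - P.[x]) c.
Proof.
move=> PP Ge A D; set z := x - e.
have EP : P.[x] = \sum_(i < size P) P^`N(i).[e] * z ^+ i.
  by rewrite -taylor_wide // /z addrC subrK.
have EP' : P'.[y] = \sum_(i < size P) P'^`N(i).[e'] * (y - e') ^+ i.
  by rewrite -taylor_wide ?(polyrel_size PP) // addrC subrK.
rewrite EP EP' -sumrB; apply: sdom_sum => i _.
have Ai : approx (P'^`N(i).[e'] * (y - e') ^+ i) (P^`N(i).[e] * z ^+ i).
  apply: approxM; last exact: approxX.
  exact/(good_approx gG)/polyrel_horner/Ge/polyrel_nderivn.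
apply: sdom_trans_dom Ai _.
have -> : e = x + - z by rewrite /z; ring.
rewrite (taylor_wide x (- z) (leqnn _)) mulr_suml; apply: dom_sum => j _.
have [w [Ow _ _ ->]] := nderivn_nderivn P i j.
have -> : w * P^`N(i + j).[x] * (- z) ^+ j * z ^+ i =
  (w * (-1) ^+ j) * (P^`N(i + j).[x] * z ^+ (i + j)) by rewrite [(- z) ^+ j]exprNn exprD; ring.
by apply: domMl (D _); apply: OM => //; apply: valOX; apply: valON; exact: O1.
Qed.

(** When the linear term dominates, [x] is a simple root in the sense of Hensel, and P' has nearly
    the same expansion at the point displaced from [e'] as [x] is from [e]. Uniqueness will identify
    the roots obtained from different centers. *)
Lemma root_transfer P P' e e' x : polyrel G P P' -> G e e' -> x - e != 0 ->
  P.[x] = 0 -> P^`N(1).[x] != 0 ->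
  (forall k, dom (P^`N(k).[x] * (x - e) ^+ k) (P^`N(1).[x] * (x - e))) ->
  (exists2 y, P'.[y] = 0 & approx (y - e') (x - e)) /\
  (forall y1 y2, P'.[y1] = 0 -> P'.[y2] = 0 -> approx (y1 - e') (x - e) ->
     approx (y2 - e') (x - e) -> y1 = y2).
Proof.
move=> PP Ge z0 P0 g0 D; set z := x - e in z0 D *; set c := P^`N(1).[x] * z in D.
have c0 : c != 0 by rewrite mulf_neq0.
pose n := (size P').+2; pose x' := e' + z.
pose f := \poly_(i < n) (P'^`N(i).[x'] * z ^+ i / c).
have fE s : f.[s] = P'.[x' + z * s] / c.
  rewrite [LHS]horner_poly (@taylor_wide P' n) ?mulr_suml; last by rewrite /n -addn2 leq_addr.
  by apply: eq_bigr => i _; rewrite exprMn; ring.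
(* The scaled coefficients of P' at [x'] agree modulo [m] with those of [P] at [x]: constant term 0,
   linear term 1, all others in [O]. *)
have close k : exists2 y, m y & P'^`N(k).[x'] * z ^+ k / c = P^`N(k).[x] * z ^+ k / c + y.
  have [||y my E] := @horner_transfer _ _ e e' x x' (c / z ^+ k) (polyrel_nderivn k PP) Ge.
  - by rewrite /x' addrAC subrr add0r; apply: approx_refl.
  - move=> j; have [w [Ow _ _ ->]] := nderivn_nderivn P k j.
    have [y Oy E] := D (k + j)%N; exists (w * y); first exact: OM.
    rewrite mulrA; apply: (mulIf (expf_neq0 k z0)); rewrite divfK ?expf_neq0 //.
    have -> : w * P^`N(k + j).[x] * (x - e) ^+ j * z ^+ k = w * (P^`N(k + j).[x] * z ^+ (k + j)).
      by rewrite -/z exprD; ring.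
    by rewrite E mulrA.
  exists y => //; have -> : P'^`N(k).[x'] = P^`N(k).[x] + y * (c / z ^+ k) by rewrite -E addrC subrK.
  by field; rewrite c0 expf_neq0.
have fO i : O f`_i.
  rewrite coef_poly; case: ifP => _; last exact: valO0.
  have [y my ->] := close i; apply: valOD; last exact: mO.
  by have [o Oo ->] := D i; rewrite mulfK.
have f1 : ~ m f`_1.
  rewrite coef_poly /=; have [y my ->] := close 1%N.
  by rewrite expr1 -/c divff //; apply: val_1Dm_unit.
have zs y : approx (y - e') z -> exists2 s, m s & y = x' + z * s.
  by move=> [s ms E]; exists s => //; rewrite mulrC -E /x'; ring.
split; last first.
  move=> y1 y2 r1 r2 /zs [s1 ms1 E1] /zs [s2 ms2 E2].
  suff E : s1 = s2 by rewrite E1 E2 E.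
  by apply: (hensel_unique fO f1) => //; rewrite fE -?E1 -?E2 ?r1 ?r2 mul0r.
have [|s ms fs] := val_hensel HO fO _ f1.
  rewrite coef_poly /=; have [y my ->] := close 0%N.
  by rewrite nderivn0 P0 !mul0r add0r.
exists (x' + z * s).
  by move/eqP: fs; rewrite fE mulf_eq0 invr_eq0 (negPf c0) orbF => /eqP.
by rewrite /approx; exists s => //; rewrite /x'; ring.
Qed.

End Good.

(** * Maximal partial isomorphisms and one-point extensions *)

Definition maximal_good G :=
  good G /\ forall G', good G' -> (forall a b, G a b -> G' a b) -> forall a b, G' a b -> G a b.

Lemma maximal_good_exists G0 : good G0 ->
  exists2 G, maximal_good G & forall a b, G0 a b -> G a b.
Proof.
move=> g0; pose S0 : set (K * K) := fun ab => G0 ab.1 ab.2.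
pose rel (A : set (K * K)) a b := A (a, b).
pose P (A : set (K * K)) := A = set0 \/ (good (rel A) /\ subset S0 A).
have [A [PA maxA]] : exists A, P A /\ forall B, (A `<` B)%classic -> ~ P B.
  apply: Zorn_bigcup => C CP Ctot.
  have [[A [CA nA]]|no] := pselect (exists A, C A /\ A <> set0); last first.
    left; apply/seteqP; split => // x [A CA Ax]; case: no; exists A; split => // A0.
    by rewrite A0 in Ax.
  right; have gC B x : C B -> B x -> good (rel B) /\ subset S0 B.
    by move=> CB Bx; case: (CP _ CB) => // B0; rewrite B0 in Bx.
  have [gA sA] : good (rel A) /\ subset S0 A by case: (CP _ CA).
  have two x y B B' : C B -> C B' -> B x -> B' y -> exists D, [/\ C D, D x & D y].
    move=> CB CB' Bx By; case: (Ctot B B' CB CB') => sub; [exists B' | exists B].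
      by split => //; apply: sub.
    by split => //; apply: sub.
  split; last by move=> x /sA Ax; exists A.
  split.
  - by exists A => //; apply: (good1 gA).
  - move=> a b c d [B CB Bx] [B' CB' By]; have [D [CD Dx Dy]] := two _ _ _ _ CB CB' Bx By.
    by exists D => //; apply: (goodB (gC _ _ CD Dx).1).
  - move=> a b c d [B CB Bx] [B' CB' By]; have [D [CD Dx Dy]] := two _ _ _ _ CB CB' Bx By.
    by exists D => //; apply: (goodM (gC _ _ CD Dx).1).
  - by move=> a b [B CB Bx]; apply: (good_approx (gC _ _ CB Bx).1).
case: PA => [A0|[gA sA]].
  case: (maxA S0); last by right; split.
  rewrite A0; split; first by [].
  by move=> /(_ (1, 1)); apply; apply: (good1 g0).
exists (rel A); last by move=> a b ab; apply: (sA (a, b)).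
split => // G' g' sub a b G'ab; apply: contrapT => nA.
apply: (maxA (fun ab => G' ab.1 ab.2)).
  by split; [move=> [c d]; apply: sub | move=> /(_ (a, b)); apply: contra_not nA; apply].
by right; split => // -[c d] /sA; apply: sub.
Qed.

Section Maximal.
Variable G : K -> K -> Prop.
Hypothesis maxG : maximal_good G.
Let gG := maxG.1.

(** Fractions with powers of [a] as denominators, paired with the corresponding fractions over [b],
    again form a good relation. Hence the domain of a maximal one is a field. *)
Lemma maximal_goodV a b : G a b -> G a^-1 b^-1.
Proof.
move=> Gab; have [a0|a0] := eqVneq a 0.
  have /eqP b0 : b == 0 by rewrite -(good_eq0 gG Gab) a0.
  by rewrite a0 b0 invr0; apply: good0.
have b0 : b != 0 by rewrite -(good_eq0 gG Gab).
pose G' c d := exists x y n, [/\ G x y, c = x / a ^+ n & d = y / b ^+ n].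
apply: (maxG.2 G').
- have common x y n k : G x y -> exists x' y', [/\ G x' y', x / a ^+ n = x' / a ^+ (n + k) & y / b ^+ n = y' / b ^+ (n + k)].
    move=> Gxy; exists (x * a ^+ k), (y * b ^+ k); split.
    + by apply: goodM => //; apply: goodX.
    + by rewrite exprD invfM mulrACA divff ?expf_neq0 ?mulr1.
    + by rewrite exprD invfM mulrACA divff ?expf_neq0 ?mulr1.
  split.
  + by exists 1, 1, 0%N; rewrite !expr0 divr1; split => //; apply: good1.
  + move=> _ _ _ _ [x [y [n [Gxy -> ->]]]] [x2 [y2 [k [Gxy2 -> ->]]]].
    have [x' [y' [Gx ->  ->]]] := common _ _ n k Gxy.
    have [x2' [y2' [Gx2 ->  ->]]] := common _ _ k n Gxy2.
    exists (x' - x2'), (y' - y2'), (n + k)%N; rewrite (addnC k) -!mulrBl.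
    by split => //; apply: goodB.
  + move=> _ _ _ _ [x [y [n [Gxy -> ->]]]] [x2 [y2 [k [Gxy2 -> ->]]]].
    exists (x * x2), (y * y2), (n + k)%N; rewrite !exprD !invfM.
    by split; [apply: goodM | ring | ring].
  + move=> _ _ [x [y [n [Gxy -> ->]]]]; apply: approxM; first exact: good_approx gG _ _ _.
    by apply: approxV; apply: approxX; apply: good_approx gG _ _ _.
- by move=> c d Gcd; exists c, d, 0%N; rewrite !expr0 !divr1.
by exists 1, 1, 1%N; rewrite !expr1 !div1r; split => //; apply: good1.
Qed.

Definition gdom a := exists b, G a b.

(* For a counterexample [x] of minimal degree, the roots of the derivatives of [P] lie in
   the domain of [G], so some center makes [x] a simple root in the sense of Hensel's lemma;
   sending [x] to the corresponding root of [P'] extends [G]. *)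
Lemma maximal_good_root P P' x : polyrel G P P' -> P != 0 -> P.[x] = 0 -> gdom x.
Proof.
move: {2}(size P) (erefl (size P)) => d; elim/ltn_ind: d P P' x => d IH P P' x sP PP P0 Px.
apply: contrapT => nEx.
have {}IH Q Q' y : polyrel G Q Q' -> (size Q < d)%N -> Q != 0 -> Q.[y] = 0 -> gdom y.
  by move=> QQ sQ; apply: (IH _ sQ _ _ _ (erefl _) QQ).
have E0 : gdom 0 by exists 0; apply: good0.
have xe a : gdom a -> x - a != 0.
  by move=> Ea; rewrite subr_eq0; apply/eqP=> xa; apply: nEx; rewrite xa.
have d0 : (0 < d)%N by rewrite -sP size_poly_gt0.
have [|e [Ee [mu mu1 D]]] := @center_exists gdom P x 1 P0 nEx E0.
  move=> nu y nu1; apply: IH (polyrel_nderivn gG nu PP) _.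
  by rewrite (leq_ltn_trans (size_nderivn _ _)) // sP ltn_subrL nu1.
have gmu : P^`N(mu).[x] != 0.
  apply: contraNneq (lead_nderivn x P0) => gz.
  have [y _] := D (size P).-1; rewrite gz mul0r mulr0 => /eqP.
  by rewrite mulf_eq0 expf_eq0 (negPf (xe _ Ee)) andbF orbF.
have {mu1} mu1 : mu = 1%N.
  by case: mu gmu mu1 {D} => [|[]] //; rewrite nderivn0 Px eqxx.
rewrite {}mu1 expr1 in D gmu; have [e' Gee] := Ee.
have [[y yr ya] _] := root_transfer gG PP Gee (xe _ Ee) Px gmu D.
(* The root found from [e] must suit every [a] in the domain. If [a] is no nearer to [x] than [e],
   this follows from [e]; if it is nearer, [a] yields a root of its own, equal to [y] by
   uniqueness. *)
have all_e a a' : G a a' -> approx (y - a') (x - a).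
  move=> Ga; have [d1|/sdom_dom d1] := dom_total (x - e) (x - a).
    exact: (approx_center gG Gee Ga).
  have Ea : gdom a by exists a'.
  have D' k : dom (P^`N(k).[x] * (x - a) ^+ k) (P^`N(1).[x] * (x - a)).
    case: k => [|k]; first by rewrite nderivn0 Px mul0r; apply: dom0.
    have [o Oo Eo] := d1; have [o' Oo' Eo'] := D k.+1.
    exists (o' * o ^+ k); first by apply: OM => //; apply: valOX.
    rewrite Eo exprMn mulrCA Eo' exprS; ring.
  have [[y1 y1r y1a] _] := root_transfer gG PP Ga (xe _ Ea) Px gmu D'.
  suff -> : y = y1 by [].
  have [_] := root_transfer gG PP Gee (xe _ Ee) Px gmu D; apply => //.
  exact: (approx_center gG Ga Gee).
(* In degree below [d] the induction hypothesis puts all roots of [Q] and of its derivatives in the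
   domain, so a center with dominant term Q(x) is available. *)
have small Q Q' : polyrel G Q Q' -> (size Q < d)%N -> approx Q'.[y] Q.[x].
  move=> QQ sQ; have [Q0|Q0] := eqVneq Q 0.
    have /eqP Q'0 : Q' == 0 by rewrite -size_poly_eq0 -(polyrel_size gG QQ) Q0 size_poly0.
    by rewrite Q0 Q'0 !horner0; apply: approx_refl.
  have [|a [[a' Ga] [nu]]] := @center_exists gdom Q x 0 Q0 nEx E0.
    move=> nu t _; apply: IH (polyrel_nderivn gG nu QQ) _.
    by rewrite (leq_ltn_trans (size_nderivn _ _)) // (leq_ltn_trans (leq_subr _ _)).
  rewrite leqn0 => /eqP-> Dk; apply: (horner_transfer gG QQ Ga (all_e _ _ Ga)) => k.
  by move: (Dk k); rewrite expr0 mulr1 nderivn0.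
(* Division by [P] and P' performed in parallel: each step cancels the leading terms by multiples of
   [P] and P', which vanish at [x] and [y]. *)
have all_Q Q Q' : polyrel G Q Q' -> approx Q'.[y] Q.[x].
  move: {2}(size Q) (leqnn (size Q)) => n; elim: n Q Q' => [|n IHn] Q Q' sQ QQ.
    by apply: small QQ _; apply: leq_ltn_trans sQ _.
  have [sQd|dsQ] := ltnP (size Q) d; first exact: small.
  pose k := (size Q - d)%N.
  pose R : {poly K} := (lead_coef Q / lead_coef P)%:P * 'X^k * P.
  pose R' : {poly K} := (lead_coef Q' / lead_coef P')%:P * 'X^k * P'.
  have GX j : polyrel G 'X^j 'X^j by apply: polyrel_exp => //; apply: polyrelX.
  have RR : polyrel G R R'.
    apply: polyrelM => //; apply: polyrelM => //; apply: polyrelC => //.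
    apply: goodM => //; last apply: maximal_goodV.
      by rewrite !lead_coefE -(polyrel_size gG QQ).
    by rewrite !lead_coefE -(polyrel_size gG PP).
  have vR : (Q - R).[x] = Q.[x] by rewrite hornerD hornerN hornerM Px mulr0 subr0.
  have vR' : (Q' - R').[y] = Q'.[y] by rewrite hornerD hornerN hornerM yr mulr0 subr0.
  rewrite -vR -vR'; apply: IHn; last exact: polyrelB.
  have Q0 : Q != 0 by rewrite -size_poly_gt0 (leq_trans d0).
  have c0 : lead_coef Q / lead_coef P != 0 by rewrite mulf_neq0 ?invr_eq0 ?lead_coef_eq0.
  have RE : R = (lead_coef Q / lead_coef P) *: ('X^k * P) by rewrite -mul_polyC mulrA.
  have sR : size R = size Q.
    by rewrite RE size_scale // mulrC size_mulXn // sP /k subnK.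
  have lR : lead_coef R = lead_coef Q.
    by rewrite RE lead_coefZ lead_coefM lead_coefXn mul1r divfK // lead_coef_eq0.
  have sQR : (size (Q - R)%R <= size Q)%N.
    by rewrite (leq_trans (size_polyD _ _)) // size_polyN sR maxnn.
  rewrite -ltnS (leq_trans _ sQ) // ltn_neqAle sQR andbT; apply/eqP=> sE.
  have : lead_coef (Q - R) = 0.
    by rewrite lead_coefE sE coefB -{2}sR -!lead_coefE lR subrr.
  move/eqP; rewrite lead_coef_eq0 => /eqP QR0.
  by move: sE Q0; rewrite QR0 size_poly0 -size_poly_eq0 => <-.
(* The ring generated by [G] and the pair (x, y). *)
pose G' a b := exists Q Q', [/\ polyrel G Q Q', a = Q.[x] & b = Q'.[y]].
have : G' x y by exists 'X, 'X; rewrite !hornerX; split => //; apply: polyrelX.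
move/(maxG.2 G') => Gxy; apply: nEx; exists y; apply: Gxy; last first.
  by move=> a b Gab; exists a%:P, b%:P; rewrite !hornerC; split => //; apply: polyrelC.
split.
- exists 1, 1; rewrite !hornerC; split => //.
  by rewrite -[1]/(1%:P); apply: polyrelC => //; apply: good1.
- move=> _ _ _ _ [Q [Q' [QQ -> ->]]] [R [R' [RR -> ->]]].
  by exists (Q - R), (Q' - R'); rewrite !hornerE; split => //; apply: polyrelB.
- move=> _ _ _ _ [Q [Q' [QQ -> ->]]] [R [R' [RR -> ->]]].
  by exists (Q * R), (Q' * R'); rewrite !hornerM; split => //; apply: polyrelM.
- by move=> _ _ [Q [Q' [QQ -> ->]]]; apply: all_Q.
Qed.

(* Each polynomial has its own center; translating by the one closest to [x] serves all. *)
Lemma maximal_good_extend x (s : seq ({poly K} * {poly K})) :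
  (forall QQ, QQ \in s -> polyrel G QQ.1 QQ.2) ->
  exists y, forall QQ, QQ \in s -> approx QQ.2.[y] QQ.1.[x].
Proof.
move=> Hs; have [[y Gxy]|nEx] := pselect (gdom x).
  by exists y => QQ /Hs H; apply: good_approx gG _ _ _; apply: polyrel_horner.
have E0 : G 0 0 by apply: good0.
have [e [e' [Gee He]]] : exists e e', G e e' /\ forall QQ, QQ \in s -> QQ.1 != 0 ->
    exists a a', [/\ G a a', dom (x - e) (x - a) &
      forall k, dom (QQ.1^`N(k).[x] * (x - a) ^+ k) QQ.1.[x]].
  elim: s Hs => [|QQ s IH] Hs; first by exists 0, 0; split.
  have [|e [e' [Gee He]]] := IH; first by move=> RR Rs; apply: Hs; rewrite inE Rs orbT.
  have [Q0|Q0] := eqVneq QQ.1 0.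
    exists e, e'; split => // RR; rewrite inE => /orP[/eqP->|]; last exact: He.
    by rewrite Q0 eqxx.
  have QQ' : polyrel G QQ.1 QQ.2 by apply: Hs; rewrite inE eqxx.
  have [||a [[a' Ga] [nu]]] := @center_exists gdom QQ.1 x 0 Q0 nEx; first by exists 0.
    by move=> nu t _; apply: maximal_good_root (polyrel_nderivn gG nu QQ').
  rewrite leqn0 => /eqP-> Dk.
  have {}Dk k : dom (QQ.1^`N(k).[x] * (x - a) ^+ k) QQ.1.[x].
    by move: (Dk k); rewrite expr0 mulr1 nderivn0.
  have [d|/sdom_dom d] := dom_total (x - e) (x - a); [exists e, e' | exists a, a'];
    split => // RR; rewrite inE => /orP[/eqP-> _|Rs R0].
  - by exists a, a'.
  - exact: He.
  - by exists a, a'; split => //; apply: dom_refl.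
  - have [b [b' [Gb db Db]]] := He _ Rs R0; exists b, b'; split => //.
    exact: dom_trans d db.
(* The displacement of [x] from the nearest center is copied at the image of that center. *)
exists (e' + (x - e)) => QQ Qs; have QQ' := Hs _ Qs.
have [Q0|Q0] := eqVneq QQ.1 0.
  have /eqP -> : QQ.2 == 0 by rewrite -size_poly_eq0 -(polyrel_size gG QQ') Q0 size_poly0.
  by rewrite Q0 !horner0; apply: approx_refl.
have [a [a' [Ga da Da]]] := He _ Qs Q0.
apply: (horner_transfer gG QQ' Ga) => //; apply: (approx_center gG Gee Ga) => //.
by rewrite addrAC subrr add0r; apply: approx_refl.
Qed.

End Maximal.
End HenselianChar0.

(** * Substitution, quantifier blocks and parameters of formulas *)

Definition upd (T : Type) (r : nat -> T) (i : nat) (t : T) : nat -> T :=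
  fun j => if j == i then t else r j.

Fixpoint tsub (A : Type) (r : nat -> GRing.term A) (t : GRing.term A) : GRing.term A :=
  match t with
  | GRing.Var i => r i
  | GRing.Const x => GRing.Const x
  | GRing.NatConst n => GRing.NatConst A n
  | GRing.Add t1 t2 => GRing.Add (tsub r t1) (tsub r t2)
  | GRing.Opp t1 => GRing.Opp (tsub r t1)
  | GRing.NatMul t1 n => GRing.NatMul (tsub r t1) n
  | GRing.Mul t1 t2 => GRing.Mul (tsub r t1) (tsub r t2)
  | GRing.Inv t1 => GRing.Inv (tsub r t1)
  | GRing.Exp t1 n => GRing.Exp (tsub r t1) n
  end.

(* Simultaneous substitution; all terms [r j] are meant to have variables below [M], so
   that bound variables can be renamed to [M], [M+1], etc. *)
Fixpoint fsub (A : Type) (M : nat) (r : nat -> GRing.term A) (f : GRing.formula A) :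
    GRing.formula A :=
  match f with
  | GRing.Bool b => GRing.Bool b
  | GRing.Equal t1 t2 => GRing.Equal (tsub r t1) (tsub r t2)
  | GRing.Unit t1 => GRing.Unit (tsub r t1)
  | GRing.And f1 f2 => GRing.And (fsub M r f1) (fsub M r f2)
  | GRing.Or f1 f2 => GRing.Or (fsub M r f1) (fsub M r f2)
  | GRing.Implies f1 f2 => GRing.Implies (fsub M r f1) (fsub M r f2)
  | GRing.Not f1 => GRing.Not (fsub M r f1)
  | GRing.Exists i f1 => GRing.Exists M (fsub M.+1 (upd r i (GRing.Var A M)) f1)
  | GRing.Forall i f1 => GRing.Forall M (fsub M.+1 (upd r i (GRing.Var A M)) f1)
  end.

Fixpoint tlt (A : Type) (M : nat) (t : GRing.term A) : bool :=
  match t with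
  | GRing.Var i => (i < M)%N
  | GRing.Add t1 t2 | GRing.Mul t1 t2 => tlt M t1 && tlt M t2
  | GRing.Opp t1 | GRing.NatMul t1 _ | GRing.Inv t1 | GRing.Exp t1 _ => tlt M t1
  | _ => true
  end.

Lemma tlt_leq (A : Type) M N (t : GRing.term A) : (M <= N)%N -> tlt M t -> tlt N t.
Proof.
move=> MN; elim: t => //=; first by move=> i /leq_trans; apply.
  by move=> t1 I1 t2 I2 /andP[/I1 -> /I2 ->].
by move=> t1 I1 t2 I2 /andP[/I1 -> /I2 ->].
Qed.

Lemma tlt_map (A B : Type) (g : A -> B) M (t : GRing.term A) : tlt M (term_map g t) = tlt M t.
Proof. by elim: t => //= t1 -> t2 ->. Qed.

Lemma tsub_map (A B : Type) (g : A -> B) (r : nat -> GRing.term A) t :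
  term_map g (tsub r t) = tsub (fun j => term_map g (r j)) (term_map g t).
Proof. by elim: t => //= [t1 -> t2 ->|t1 ->|t1 -> n|t1 -> t2 ->|t1 ->|t1 -> n]. Qed.

Lemma fsub_map (A B : Type) (g : A -> B) M (r : nat -> GRing.term A) f :
  form_map g (fsub M r f) = fsub M (fun j => term_map g (r j)) (form_map g f).
Proof.
have updE i N (s : nat -> GRing.term A) : (fun j => term_map g (upd s i (GRing.Var A N) j))
    = upd (fun j => term_map g (s j)) i (GRing.Var B N).
  by apply: funext => j; rewrite /upd; case: ifP.
elim: f M r => //=; try by [move=> *; rewrite !tsub_map | move=> f1 I1 f2 I2 M r; rewrite I1 I2].
- by move=> f1 I1 M r; rewrite I1.
- by move=> i f1 I1 M r; rewrite I1 updE.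
- by move=> i f1 I1 M r; rewrite I1 updE.
Qed.

Section Subst.
Variable R : unitRingType.
Implicit Types (e : seq R) (f : GRing.formula R).

Lemma eval_set_nth e M i x t : tlt M t -> (M <= i)%N ->
  GRing.eval (set_nth 0 e i x) t = GRing.eval e t.
Proof.
move=> + Mi; elim: t => //=.
- move=> j jM; rewrite nth_set_nth /= ifN //; apply: contraTneq jM => ->.
  by rewrite -leqNgt.
- by move=> t1 I1 t2 I2 /andP[/I1 -> /I2 ->].
- by move=> t I /I ->.
- by move=> t I n /I ->.
- by move=> t1 I1 t2 I2 /andP[/I1 -> /I2 ->].
- by move=> t I /I ->.
- by move=> t I n /I ->.
Qed.

Lemma eval_tsub (r : nat -> GRing.term R) e e' t :
  (forall j, GRing.eval e (r j) = e'`_j) -> GRing.eval e (tsub r t) = GRing.eval e' t.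
Proof. by move=> H; elim: t => //= [t1 -> t2 ->|t1 ->|t1 -> n|t1 -> t2 ->|t1 ->|t1 -> n]. Qed.

Lemma holds_fsub M (r : nat -> GRing.term R) e e' f :
  (forall j, tlt M (r j)) -> (forall j, GRing.eval e (r j) = e'`_j) ->
  GRing.holds e (fsub M r f) <-> GRing.holds e' f.
Proof.
have step N (s : nat -> GRing.term R) e1 e2 i x : (forall j, tlt N (s j)) ->
    (forall j, GRing.eval e1 (s j) = e2`_j) ->
    (forall j, tlt N.+1 (upd s i (GRing.Var R N) j)) /\
    (forall j, GRing.eval (set_nth 0 e1 N x) (upd s i (GRing.Var R N) j)
               = (set_nth 0 e2 i x)`_j).
  move=> sN E; split=> j; rewrite /upd; case: (eqVneq j i) => ji /=.
  - by rewrite ltnSn.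
  - exact: tlt_leq (sN j).
  - by rewrite !nth_set_nth /= ji !eqxx.
  - by rewrite (eval_set_nth _ _ (sN j)) // nth_set_nth /= (negPf ji).
elim: f M r e e' => /=.
- by [].
- by move=> t1 t2 M r e e' _ H; rewrite !(eval_tsub _ H).
- by move=> t M r e e' _ H; rewrite !(eval_tsub _ H).
- by move=> f1 I1 f2 I2 M r e e' rM H; rewrite (I1 _ _ _ _ rM H) (I2 _ _ _ _ rM H).
- by move=> f1 I1 f2 I2 M r e e' rM H; rewrite (I1 _ _ _ _ rM H) (I2 _ _ _ _ rM H).
- by move=> f1 I1 f2 I2 M r e e' rM H; rewrite (I1 _ _ _ _ rM H) (I2 _ _ _ _ rM H).
- by move=> f1 I1 M r e e' rM H; rewrite (I1 _ _ _ _ rM H).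
- move=> i f1 I1 M r e e' rM H; split=> -[x Hx]; exists x;
  have [rM' H'] := step M r e e' i x rM H; exact/(I1 _ _ _ _ rM' H').
- move=> i f1 I1 M r e e' rM H; split=> Hx x; have [rM' H'] := step M r e e' i x rM H;
  exact/(I1 _ _ _ _ rM' H').
Qed.

Fixpoint exq (A : Type) (i n : nat) (f : GRing.formula A) : GRing.formula A :=
  if n is n'.+1 then GRing.Exists i (exq i.+1 n' f) else f.

Lemma holds_exq e n f :
  GRing.holds e (exq (size e) n f) <-> exists r, size r = n /\ GRing.holds (e ++ r) f.
Proof.
elim: n e => [|n IH] e /=.
  split=> [H|[r [/size0nil -> ]]]; last by rewrite cats0.
  by exists [::]; rewrite cats0.
have sE x : set_nth 0 e (size e) x = rcons e x.
  by elim: e {IH} => //= y e ->.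
have IHx x : GRing.holds (rcons e x) (exq (size e).+1 n f) <-> exists r,
    size r = n /\ GRing.holds (e ++ x :: r) f.
  by have := IH (rcons e x); rewrite size_rcons; under eq_exists do rewrite cat_rcons.
split=> [[x]|[[|x r] [//= [sr] H]]].
  by rewrite sE => /IHx [r [sr H]]; exists (x :: r) => /=; rewrite sr.
by exists x; rewrite sE; apply/IHx; exists r.
Qed.

Fixpoint fconj (A T : Type) (phi : T -> GRing.formula A) (s : seq T) : GRing.formula A :=
  if s is t :: s' then GRing.And (phi t) (fconj phi s') else GRing.Bool true.

Lemma holds_fconj (T : Type) (phi : T -> GRing.formula R) e s :
  GRing.holds e (fconj phi s) <-> forall t, inL t s -> GRing.holds e (phi t).
Proof.
elim: s => [|t s IH] //=; rewrite IH; split=> [[Ht Hs] t' [<-|/Hs]|H] //.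
by split=> [|t' ts]; apply: H; [left | right].
Qed.

End Subst.

Lemma exq_map (A B : Type) (g : A -> B) i n f : form_map g (exq i n f) = exq i n (form_map g f).
Proof. by elim: n i => //= n IH i; rewrite IH. Qed.

Lemma fconj_map (A B T : Type) (g : A -> B) (phi : T -> GRing.formula A) s :
  form_map g (fconj phi s) = fconj (fun t => form_map g (phi t)) s.
Proof. by elim: s => //= t s ->. Qed.

Lemma inL_cat (T : Type) (x : T) s1 s2 : inL x (s1 ++ s2) <-> inL x s1 \/ inL x s2.
Proof. by elim: s1 => [|y s IH] /=; [tauto | rewrite IH; tauto]. Qed.

Lemma term_map_consts (A B : Type) (g : A -> B) t c :
  inL c (term_consts (term_map g t)) -> exists a, c = g a.
Proof.
elim: t => //=.
- by move=> x [<-|//]; exists x.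
- by move=> t1 I1 t2 I2 /inL_cat [/I1|/I2].
- by move=> t1 I1 t2 I2 /inL_cat [/I1|/I2].
Qed.

Lemma form_map_consts (A B : Type) (g : A -> B) f c :
  inL c (form_consts (form_map g f)) -> exists a, c = g a.
Proof.
elim: f => //=.
- by move=> t1 t2 /inL_cat [] H; exact: term_map_consts H.
- by move=> t; apply: term_map_consts.
- by move=> f1 I1 f2 I2 /inL_cat [/I1|/I2].
- by move=> f1 I1 f2 I2 /inL_cat [/I1|/I2].
- by move=> f1 I1 f2 I2 /inL_cat [/I1|/I2].
Qed.

Lemma tsub_consts (A : Type) (C : A -> Prop) (r : nat -> GRing.term A) t c :
  (forall j c, inL c (term_consts (r j)) -> C c) ->
  inL c (term_consts (tsub r t)) -> C c \/ inL c (term_consts t).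
Proof.
move=> H; elim: t => //=.
- by move=> i /H; left.
- by move=> x [<-|//]; right; left.
- by move=> t1 I1 t2 I2 /inL_cat [/I1|/I2]; rewrite inL_cat; tauto.
- by move=> t1 I1 t2 I2 /inL_cat [/I1|/I2]; rewrite inL_cat; tauto.
Qed.

Lemma fsub_consts (A : Type) (C : A -> Prop) M (r : nat -> GRing.term A) f c :
  (forall j c, inL c (term_consts (r j)) -> C c) ->
  inL c (form_consts (fsub M r f)) -> C c \/ inL c (form_consts f).
Proof.
have U N (s : nat -> GRing.term A) i : (forall j c, inL c (term_consts (s j)) -> C c) ->
    (forall j c, inL c (term_consts (upd s i (GRing.Var A N) j)) -> C c).
  by move=> H j d; rewrite /upd; case: ifP => // _; apply: H.
elim: f M r => //=.
- by move=> t1 t2 M r H /inL_cat [] /(tsub_consts H); rewrite inL_cat; tauto.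
- by move=> t M r H H1; exact: tsub_consts H H1.
- by move=> f1 I1 f2 I2 M r H /inL_cat [/(I1 _ _ H)|/(I2 _ _ H)]; rewrite inL_cat; tauto.
- by move=> f1 I1 f2 I2 M r H /inL_cat [/(I1 _ _ H)|/(I2 _ _ H)]; rewrite inL_cat; tauto.
- by move=> f1 I1 f2 I2 M r H /inL_cat [/(I1 _ _ H)|/(I2 _ _ H)]; rewrite inL_cat; tauto.
- by move=> i f1 I1 M r H; apply: I1; apply: U.
- by move=> i f1 I1 M r H; apply: I1; apply: U.
Qed.

(** * Saturation in several variables *)

Definition small (T : Type) (A : T -> Prop) :=
  exists g : T -> (nat -> bool), forall x y, A x -> A y -> g x = g y -> x = y.

(** One more bit, put in front of the code, tells whether the element is [a]. *)
Lemma small_add (T : eqType) (A : T -> Prop) a : small A -> small (fun x => A x \/ x = a).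
Proof.
move=> [g Hg]; exists (fun x n => if n is k.+1 then (x != a) && g x k else x == a).
move=> x y Ax Ay E; have := congr1 (@^~ 0%N) E => /= E0.
have [xa|xa] := eqVneq x a; first by move: E0; rewrite xa eqxx => /esym/eqP.
have ya : y != a by rewrite -E0.
have Ax' : A x by case: Ax => // /eqP; rewrite (negPf xa).
have Ay' : A y by case: Ay => // /eqP; rewrite (negPf ya).
apply: Hg => //; apply: funext => n; have := congr1 (@^~ n.+1) E => /=.
by rewrite xa ya.
Qed.

Lemma small_add_seq (T : eqType) (A : T -> Prop) (s : seq T) :
  small A -> small (fun x => A x \/ x \in s).
Proof.
move=> sA; elim: s => [|a s [g Hg]].
  by have [g Hg] := sA; exists g => x y [Ax|//] [Ay|//]; apply: Hg.
have [g' Hg'] := small_add a (ex_intro _ g Hg : small (fun x => A x \/ x \in s)).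
exists g' => x y Hx Hy; apply: Hg'.
  by case: Hx => [|/[!inE]/orP[/eqP|]]; tauto.
by case: Hy => [|/[!inE]/orP[/eqP|]]; tauto.
Qed.

(** Coordinates are realized one at a time: the 1-type of the next one says, for each finite set of
    conditions, that the remaining coordinates exist. Those already found become parameters. *)
Lemma saturated_multi (F K : fieldType) (iota : F -> K) (T : Type)
    (phi : T -> GRing.formula F) n (e0 : seq K) :
  continuum_plus_saturated K -> small (fun x : K => exists a, x = iota a) ->
  (forall s : seq T, exists r, size r = n /\
     forall t, inL t s -> GRing.holds (e0 ++ r) (form_map iota (phi t))) ->
  exists r, size r = n /\ forall t, GRing.holds (e0 ++ r) (form_map iota (phi t)).
Proof.
move=> Hsat sF; elim: n e0 => [|n IH] e0 H.
  exists [::]; split=> // t; have [r [/size0nil-> Hr]] := H [:: t].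
  by apply: Hr; left.
pose j := size e0.
(* Saturation speaks of environments with one entry: the known coordinates are inserted as
   constants, the new one becomes variable 0, and the rest read as 0, the default beyond the
   environment. *)
pose r i := if (i < j)%N then GRing.Const e0`_i else
  if i == j then GRing.Var K 0 else GRing.NatConst K 0.
pose Tf s := fsub 1 r (form_map iota (exq j.+1 n (fconj phi s))).
have TfE x s : GRing.holds [:: x] (Tf s) <-> exists r, size r = n /\
    forall t, inL t s -> GRing.holds (rcons e0 x ++ r) (form_map iota (phi t)).
  rewrite (@holds_fsub _ _ _ _ (rcons e0 x)); last 2 first.
  - by move=> i; rewrite /r; case: ifP => // _; case: ifP.
  - move=> i; rewrite nth_rcons -/j /r; case: ifP => // _.
    by case: ifP.
  rewrite exq_map fconj_map -/j -(size_rcons e0 x) holds_exq.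
  by split=> -[r' [sr Hr]]; exists r'; split=> //; apply/holds_fconj.
pose Sg f := exists s, f = Tf s.
have [|||x Hx] := Hsat (fun x => (exists a, x = iota a) \/ x \in e0) Sg.
- exact: small_add_seq.
- move=> _ [s ->] c /(fsub_consts (C := fun x => x \in e0)) [].
  + move=> i d; rewrite /r; case: ifP => [ij /= [<-|//]|_]; last by case: ifP.
    exact: mem_nth.
  + by right.
  + by move=> H1; left; exact: form_map_consts H1.
- move=> l Hl.
  have [s Hs] : exists s, forall f, inL f l -> exists s', f = Tf s' /\ forall t, inL t s' -> inL t s.
    elim: l Hl => [|f l IHl] Hl; first by exists [::].
    have [|s Hs] := IHl; first by move=> g gl; apply: Hl; right.
    have [s1 E1] : Sg f by apply: Hl; left.
    exists (s1 ++ s) => g [<-|/Hs [s' [-> sub]]].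
      by exists s1; split=> // t t1; apply/inL_cat; left.
    by exists s'; split=> // t /sub ts; apply/inL_cat; right.
  have [[|x r'] [//= [sr] Hr]] := H s; exists x => f /Hs [s' [-> sub]].
  apply/TfE; exists r'; split=> // t /sub /Hr.
  by rewrite cat_rcons.
have [s|r' [sr Hr]] := IH (rcons e0 x); first by apply/TfE/Hx; exists s.
by exists (x :: r'); rewrite /= sr; split=> // t; rewrite -cat_rcons.
Qed.

(** * The valuation of Q_p *)

Section Qp.
Variables (p : nat) (F : fieldType) (v : F -> int).
Hypotheses (pp : prime p) (HF : is_Qp p F v).

Let vM : forall x y : F, x != 0 -> y != 0 -> v (x * y) = v x + v y.
Proof. by case: HF => _ []. Qed.
Let vD : forall x y : F, x != 0 -> y != 0 -> x + y != 0 -> Num.min (v x) (v y) <= v (x + y).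
Proof. by case: HF => _ []. Qed.

Lemma Qp_natr n : n.+1%:R != 0 :> F.
Proof. by case: HF => /pcharf0P H _; rewrite H. Qed.

Let v1 : v 1 = 0.
Proof. have : v (1 * 1) = v 1 + v 1 by apply: vM; apply: oner_neq0.
by rewrite mulr1; lia. Qed.

Let vN x : x != 0 -> v (- x) = v x.
Proof.
have n0 : -1 != 0 :> F by rewrite oppr_eq0 oner_eq0.
have vN1 : v (-1) = 0 by have := vM n0 n0; rewrite mulrNN mulr1 v1; lia.
by move=> x0; rewrite -mulN1r vM // vN1 add0r.
Qed.

Let vV x : x != 0 -> v x^-1 = - v x.
Proof. by move=> x0; have := vM x0 (invr_neq0 x0); rewrite divff // v1; lia. Qed.

Let vp : v p%:R = 1.
Proof.
case: HF => _ [_ _ vq _ _]; have p0 := prime_gt0 pp.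
have := vq p%:R; rewrite ratr_nat => ->; last by rewrite pnatr_eq0 -lt0n.
rewrite /padic_val_rat pmulrn numq_int denq_int /= logn1 subr0.
by rewrite -{2}[p]expn1 pfactorK.
Qed.

Lemma Qp_p_neq0 : p%:R != 0 :> F.
Proof. by case: p (prime_gt0 pp) => // n _; apply: Qp_natr. Qed.

Let vpX n : v (p%:R ^+ n) = n%:Z.
Proof.
elim: n => [|n IH]; first by rewrite expr0 v1.
by rewrite exprS vM ?expf_neq0 ?Qp_p_neq0 // IH vp; lia.
Qed.

Definition val_ge (n : int) (x : F) := x = 0 \/ n <= v x.

Lemma val_geN n x : val_ge n x -> val_ge n (- x).
Proof.
have [->|x0] := eqVneq x 0; first by rewrite oppr0.
case=> [/eqP|]; first by rewrite (negPf x0).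
by rewrite -(vN x0); right.
Qed.

Lemma val_geD n x y : val_ge n x -> val_ge n y -> val_ge n (x + y).
Proof.
case=> [->|nx]; first by rewrite add0r.
have [->|x0] := eqVneq x 0; first by rewrite add0r.
case=> [->|ny]; first by rewrite addr0; right.
have [->|y0] := eqVneq y 0; first by rewrite addr0; right.
have [->|xy0] := eqVneq (x + y) 0; first by left.
by right; have := vD x0 y0 xy0; lia.
Qed.

Lemma val_geB n x y : val_ge n x -> val_ge n y -> val_ge n (x - y).
Proof. by move=> nx ny; apply: val_geD => //; apply: val_geN. Qed.

Lemma val_geM n k x y : val_ge n x -> val_ge k y -> val_ge (n + k) (x * y).
Proof.
case=> [->|nx]; first by rewrite mul0r; left.
have [->|x0] := eqVneq x 0; first by rewrite mul0r; left.
case=> [->|ny]; first by rewrite mulr0; left.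
have [->|y0] := eqVneq y 0; first by rewrite mulr0; left.
by right; rewrite vM //; lia.
Qed.

Lemma val_ge_leq n k x : k <= n -> val_ge n x -> val_ge k x.
Proof. by move=> kn [->|nx]; [left | right; lia]. Qed.

Lemma val_ge0_1 : val_ge 0 1.
Proof. by right; rewrite v1. Qed.

Lemma val_ge0X x n : val_ge 0 x -> val_ge 0 (x ^+ n).
Proof.
move=> Vx; elim: n => [|n IH]; first by rewrite expr0; apply: val_ge0_1.
by rewrite exprS -(addr0 0); apply: val_geM.
Qed.

Lemma val_ge_sum n (I : Type) (r : seq I) (P : pred I) (f : I -> F) :
  (forall i, P i -> val_ge n (f i)) -> val_ge n (\sum_(i <- r | P i) f i).
Proof.
by move=> H; elim/big_rec: _ => [|i x Pi nx]; [left | apply: val_geD => //; apply: H].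
Qed.

Lemma val_geVp (n : nat) x : val_ge n x <-> val_ge 0 (x / p%:R ^+ n).
Proof.
have q0 : p%:R ^+ n != 0 :> F by rewrite expf_neq0 ?Qp_p_neq0.
split=> H.
  rewrite -(subrr n%:Z); apply: val_geM => //.
  by right; rewrite vV // vpX.
rewrite -(divfK q0 x) -[n%:Z]add0r; apply: val_geM => //.
by right; rewrite vpX.
Qed.

Lemma val_ge_all0 x : (forall n : nat, val_ge n x) -> x = 0.
Proof. by move=> H; case: (H `|v x|.+1%N) => //; lia. Qed.

Lemma val_ge0_scale x : exists n : nat, val_ge 0 (p%:R ^+ n * x).
Proof.
have [->|x0] := eqVneq x 0; first by exists 0%N; left; rewrite mulr0.
exists `|v x|%N; right; rewrite vM ?expf_neq0 ?Qp_p_neq0 // vpX; lia.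
Qed.

Lemma val_ge0_total x : x != 0 -> val_ge 0 x \/ val_ge 1 x^-1.
Proof.
move=> x0; have [vx|vx] := lerP 0 (v x); [left | right]; right => //.
rewrite vV //; lia.
Qed.

Lemma val_ge_contract (Q : {poly F}) n s t : (forall i, val_ge 1 Q`_i) ->
  val_ge 0 s -> val_ge 0 t -> val_ge n (s - t) -> val_ge (n + 1) (Q.[s] - Q.[t]).
Proof.
move=> HQ Vs Vt Hst; rewrite !horner_coef -sumrB; apply: val_ge_sum => i _.
rewrite -mulrBr subrXX mulrCA; apply: val_geM => //.
rewrite -(addr0 1); apply: val_geM => //.
by apply: val_ge_sum => j _; rewrite -(addr0 0); apply: val_geM; apply: val_ge0X.
Qed.

(** The root is the fixed point of the contraction sending s to -1 - Q(s), a limit of iterates by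
    completeness. This normal form restricts the coefficients only, which suits a first-order
    transfer. *)
Lemma Qp_hensel (Q : {poly F}) : (forall i, val_ge 1 Q`_i) ->
  exists2 s, val_ge 0 s & 1 + s + Q.[s] = 0.
Proof.
move=> HQ; pose T s := - 1 - Q.[s]; pose u k := iter k T 0.
have Q0 s : val_ge 0 s -> val_ge 0 Q.[s].
  move=> Vs; rewrite horner_coef; apply: val_ge_sum => i _.
  apply: (@val_ge_leq 1) => //; rewrite -(addr0 1); apply: val_geM => //.
  exact: val_ge0X.
have Vu k : val_ge 0 (u k).
  elim: k => [|k IH]; first by left.
  by apply: val_geB; [apply/val_geN/val_ge0_1 | apply: Q0].
have du (k : nat) : val_ge k (u k.+1 - u k).
  elim: k => [|k IH]; first exact: val_geB.
  have -> : u k.+2 - u k.+1 = - (Q.[u k.+1] - Q.[u k]) by rewrite /= /T; ring.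
  apply: val_geN; have -> : k.+1%:Z = k%:Z + 1 by lia.
  exact: val_ge_contract.
have du2 (k i : nat) : val_ge k (u (k + i)%N - u k).
  elim: i => [|i IH]; first by left; rewrite addn0 subrr.
  have -> : u (k + i.+1)%N - u k = (u (k + i).+1 - u (k + i)%N) + (u (k + i)%N - u k).
    by rewrite addnS; ring.
  by apply: val_geD => //; apply: val_ge_leq (du _); lia.
have cauchy (k i j : nat) : (k <= i)%N -> (k <= j)%N -> val_ge k (u i - u j).
  move=> /subnKC <- /subnKC <-; set a := u _; set b := u _.
  have -> : a - b = (a - u k) - (b - u k) by ring.
  by apply: val_geB; apply: du2.
have [l Hl] : exists l, forall n : int, exists N : nat, forall i, (N <= i)%N ->
    u i = l \/ n <= v (u i - l).
  case: HF => _ [_ _ _ _]; apply => n; exists `|n|%N => i j ni nj.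
  case: (cauchy `|n|%N i j ni nj) => [/eqP|H]; first by rewrite subr_eq0 => /eqP; left.
  by right; apply: le_trans H; lia.
have {}Hl (n : nat) : exists N : nat, forall i, (N <= i)%N -> val_ge n (u i - l).
  have [N HN] := Hl n; exists N => i /HN [->|]; first by left; rewrite subrr.
  by right.
have Vl : val_ge 0 l.
  have [N /(_ N (leqnn _)) HN] := Hl 0%N.
  have -> : l = u N - (u N - l) by ring.
  by apply: val_geB; [apply: Vu | apply: HN].
exists l => //; apply: val_ge_all0 => n; have [N HN] := Hl n.
have -> : 1 + l + Q.[l] = - (u N.+1 - l) - (Q.[u N] - Q.[l]) by rewrite /= /T; ring.
apply: val_geB; first by apply/val_geN/HN.
apply: (@val_ge_leq (n%:Z + 1)); first by lia.
by apply: val_ge_contract => //; apply: HN.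
Qed.

(** By density a point is determined by the balls with rational center and integer radius that
    contain it; these are countably many bits. *)
Lemma Qp_small : small (fun _ : F => True).
Proof.
case: HF => _ [_ _ _ dense _].
exists (fun x k => if unpickle k is Some (n, q) then `[< val_ge (Posz n) (x - ratr q) >] else false).
move=> x y _ _ E; apply/eqP; rewrite -subr_eq0; apply/eqP; apply: val_ge_all0 => n.
have [q Hq] := dense x n.
have xq : val_ge n (x - ratr q) by case: Hq => [->|]; [left; rewrite subrr | right].
have := congr1 (@^~ (pickle (n, q))) E; rewrite /= pickleK => Eq.
have yq : val_ge n (y - ratr q) by apply/asboolP; rewrite -Eq; apply/asboolP.
have -> : x - y = (x - ratr q) - (y - ratr q) by ring.
exact: val_geB.
Qed.

End Qp.

Lemma inLP (T : eqType) (x : T) s : inL x s <-> x \in s.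
Proof.
elim: s => [|y s IH] //=; rewrite inE IH eq_sym; split=> [[->|->]|/orP[/eqP|]].
- by rewrite eqxx.
- by rewrite orbT.
- by left.
- by right.
Qed.

Lemma tlt_tsub (A : Type) M (r : nat -> GRing.term A) t :
  (forall j, tlt M (r j)) -> tlt M (tsub r t).
Proof. by move=> H; elim: t => //= t1 -> t2 ->. Qed.

(* Variables [0], ..., [n-1] moved to [k], ..., [k+n-1]; the others read as [0], as they do
   in an environment of size [n]. *)
Definition shift_var (A : Type) (n k j : nat) : GRing.term A :=
  if (j < n)%N then GRing.Var A (k + j) else GRing.NatConst A 0.

Lemma tlt_shift_var (A : Type) n k M j : (k + n <= M)%N -> tlt M (shift_var A n k j).
Proof.
by rewrite /shift_var; case: ifP => //= jn; apply: leq_trans; rewrite ltn_add2l.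
Qed.

Lemma shift_var_map (A B : Type) (g : A -> B) n k j :
  term_map g (shift_var A n k j) = shift_var B n k j.
Proof. by rewrite /shift_var; case: ifP. Qed.

Lemma eval_shift_var (R : unitRingType) (e1 e2 e3 : seq R) n k j : size e1 = k -> size e2 = n ->
  GRing.eval (e1 ++ e2 ++ e3) (shift_var R n k j) = e2`_j.
Proof.
move=> s1 s2; rewrite /shift_var; case: ltnP => jn /=; last by rewrite nth_default ?s2.
by rewrite !nth_cat s1 s2 addKn jn ltnNge leq_addr.
Qed.

(** * Hensel's lemma as a first-order scheme *)

Section HenselFormula.
Variables (R : fieldType) (W : R -> Prop) (p d : nat).
Variables (w1 : nat -> GRing.formula R) (w2 : GRing.formula R).
Hypothesis w1P : forall e i, GRing.holds e (w1 i) <-> W (e`_i / p%:R).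
Hypothesis w2P : forall e, GRing.holds e w2 <-> W e`_d.

Fixpoint sumT (A : Type) (d n : nat) : GRing.term A :=
  if n is n'.+1 then
    GRing.Add (sumT A d n') (GRing.Mul (GRing.Var A n') (GRing.Exp (GRing.Var A d) n'))
  else GRing.NatConst A 0.

(** One sentence for each number [d] of coefficients. Variables below [d] are the coefficients,
    variable [d] is the root, and universal quantification is a negated [exq]. *)
Definition hensel_formula (A : Type) (d : nat) (v1 : nat -> GRing.formula A) (v2 : GRing.formula A) :=
  GRing.Not (exq 0 d (GRing.And (fconj v1 (iota 0 d)) (GRing.Not (exq d 1 (GRing.And v2
    (GRing.Equal (GRing.Add (GRing.Add (GRing.NatConst A 1) (GRing.Var A d)) (sumT A d d))
       (GRing.NatConst A 0))))))).

Lemma eval_sumT (e : seq R) n : GRing.eval e (sumT R d n) = \sum_(i < n) e`_i * e`_d ^+ i.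
Proof. by elim: n => [|n IH] /=; [rewrite big_ord0 | rewrite big_ord_recr /= IH]. Qed.

Lemma holds_hensel_formula : GRing.holds [::] (hensel_formula d w1 w2) <->
  forall r : seq R, size r = d -> (forall i, (i < d)%N -> W (r`_i / p%:R)) ->
    exists s, W s /\ 1 + s + \sum_(i < d) r`_i * s ^+ i = 0.
Proof.
have inner (r : seq R) : size r = d -> GRing.holds r (exq d 1 (GRing.And w2
    (GRing.Equal (GRing.Add (GRing.Add (GRing.NatConst R 1) (GRing.Var R d)) (sumT R d d))
       (GRing.NatConst R 0)))) <-> exists s, W s /\ 1 + s + \sum_(i < d) r`_i * s ^+ i = 0.
  move=> sr; have key s : (r ++ [:: s])`_d = s by rewrite nth_cat sr ltnn subnn.
  have sumE s : \sum_(i < d) (r ++ [:: s])`_i * s ^+ i = \sum_(i < d) r`_i * s ^+ i.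
    by apply: eq_bigr => i _; rewrite nth_cat sr ltn_ord.
  set f := GRing.And _ _; have := holds_exq r 1 f; rewrite sr => ->; rewrite {}/f; split=> [[l [sl]]|[s [Ws E]]].
    case: l sl => [|s [|]] //= _ [/w2P].
    by rewrite eval_sumT key sumE; exists s.
  by exists [:: s]; split=> //=; split; [apply/w2P | rewrite eval_sumT]; rewrite key ?sumE.
rewrite /hensel_formula /=; split=> [H r sr Hr|H].
  apply: contrapT => nE; apply: H; apply/(holds_exq [::]); exists r; split=> //=; split.
    by apply/holds_fconj => i /inLP; rewrite mem_iota => /andP[_ id]; apply/w1P/Hr.
  by move/(inner _ sr).
move/(holds_exq [::]) => [r [sr [/= /holds_fconj Hr]]]; apply; apply/(inner _ sr)/H => // i id.
by apply/w1P/Hr/inLP; rewrite mem_iota.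
Qed.

End HenselFormula.

Lemma hensel_formula_map (A B : Type) (g : A -> B) d v1 v2 :
  form_map g (hensel_formula d v1 v2) =
  hensel_formula d (fun i => form_map g (v1 i)) (form_map g v2).
Proof.
have sumT_map n : term_map g (sumT A d n) = sumT B d n by elim: n => //= n ->.
by rewrite /hensel_formula /= exq_map /= fconj_map sumT_map.
Qed.

(** * Transfer of the valuation to the saturated extension *)

Section Main.
Variables (p : nat) (F : fieldType) (v : F -> int).
Hypotheses (pp : prime p) (HF : is_Qp p F v).
Variables (K : fieldType) (iota : {rmorphism F -> K}).
Hypotheses (Hel : elementary iota) (Hsat : continuum_plus_saturated K).
Variable phi : GRing.formula F.
Hypothesis Hphi : forall x : F, GRing.holds [:: x] phi <-> (x = 0 \/ 0 <= v x).

Local Notation "f ^K" := (form_map iota f) (at level 2, format "f ^K").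
Local Notation "t ^t" := (term_map iota t) (at level 2, format "t ^t").
Local Notation V := (fun y : K => GRing.holds [:: y] phi^K).

Definition valF (A : Type) (f : GRing.formula A) M (t : GRing.term A) :=
  fsub M (fun j => if j == 0%N then t else GRing.NatConst A 0) f.

Arguments valF : simpl never.

Lemma holds_valF (R : unitRingType) (f : GRing.formula R) e M t : tlt M t ->
  GRing.holds e (valF f M t) <-> GRing.holds [:: GRing.eval e t] f.
Proof.
move=> tM; apply: holds_fsub => j; first by case: ifP.
by case: j => //= j; rewrite nth_nil.
Qed.

Lemma valF_map M t : (valF phi M t)^K = valF phi^K M t^t.
Proof.
rewrite /valF fsub_map; congr fsub; apply: funext => j.
by case: ifP.
Qed.

Lemma holds_valF_F e M t : tlt M t ->
  GRing.holds e (valF phi M t) <-> val_ge v 0 (GRing.eval e t).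
Proof. by move=> tM; rewrite holds_valF. Qed.

Lemma holds_valF_K e M t : tlt M t ->
  GRing.holds e (valF phi M t)^K <-> V (GRing.eval e t^t).
Proof. by move=> tM; rewrite valF_map holds_valF ?tlt_map. Qed.

Lemma V_iota x : V (iota x) <-> val_ge v 0 x.
Proof. by rewrite /val_ge -Hphi; split=> /(Hel phi [:: x]). Qed.

Let X0 : GRing.term F := GRing.Var F 0.
Let X1 : GRing.term F := GRing.Var F 1.

Lemma V_sub x y : V x -> V y -> V (x - y).
Proof.
have := Hel (GRing.Forall 0 (GRing.Forall 1 (GRing.Implies (valF phi 2 X0)
  (GRing.Implies (valF phi 2 X1) (valF phi 2 (GRing.Add X0 (GRing.Opp X1))))))) [::].
rewrite /= => -[H _] Vx Vy; have := H _ x y; rewrite !holds_valF_K //; apply=> //.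
by move=> a b; rewrite !holds_valF_F //=; apply: (val_geB pp HF).
Qed.

Lemma V_mul x y : V x -> V y -> V (x * y).
Proof.
have := Hel (GRing.Forall 0 (GRing.Forall 1 (GRing.Implies (valF phi 2 X0)
  (GRing.Implies (valF phi 2 X1) (valF phi 2 (GRing.Mul X0 X1)))))) [::].
rewrite /= => -[H _] Vx Vy; have := H _ x y; rewrite !holds_valF_K //; apply=> //.
by move=> a b; rewrite !holds_valF_F //= -{3}(addr0 0); apply: (val_geM pp HF).
Qed.

Lemma V_total x : x != 0 -> V x \/ V (x^-1 / p%:R).
Proof.
have := Hel (GRing.Forall 0 (GRing.Or (GRing.Equal X0 (GRing.NatConst F 0))
  (GRing.Or (valF phi 1 X0) (valF phi 1 (GRing.Mul (GRing.Inv X0) (GRing.Inv (GRing.NatConst F p))))))) [::].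
rewrite /= => -[H _] x0; have := H _ x; rewrite !holds_valF_K //= => -[|/eqP|//].
  move=> a; rewrite !holds_valF_F //=; have [->|a0] := eqVneq a 0; first by left.
  right; case: (val_ge0_total pp HF a0); first by left.
  by move/(val_geVp pp HF 1); rewrite expr1; right.
by rewrite (negPf x0).
Qed.

Lemma V_hensel (r : seq K) : (forall i, (i < size r)%N -> V (r`_i / p%:R)) ->
  exists s, V s /\ 1 + s + \sum_(i < size r) r`_i * s ^+ i = 0.
Proof.
set d := size r.
pose w1 i := valF phi i.+1 (GRing.Mul (GRing.Var F i) (GRing.Inv (GRing.NatConst F p))).
pose w2 := valF phi d.+1 (GRing.Var F d).
have := Hel (hensel_formula d w1 w2) [::]; rewrite hensel_formula_map -[map _ _]/[::].
rewrite (@holds_hensel_formula F (val_ge v 0) p); last 2 first.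
- by move=> e i; rewrite /w1 holds_valF_F /= ?ltnSn.
- by move=> e; rewrite /w2 holds_valF_F /= ?ltnSn.
rewrite (@holds_hensel_formula K V p); last 2 first.
- by move=> e i; rewrite /w1 holds_valF_K /= ?ltnSn.
- by move=> e; rewrite /w2 holds_valF_K /= ?ltnSn.
case=> H _ Hr; apply: H Hr => // r' sr Hr.
have [|s Vs E] := Qp_hensel pp HF (Q := Poly r').
  move=> i; rewrite coef_Poly; have [id|id] := ltnP i d.
    by apply/(val_geVp pp HF 1); rewrite expr1; apply: Hr.
  by left; rewrite nth_default // sr.
exists s; split=> //; rewrite -[RHS]E; congr (_ + _).
rewrite (@horner_coef_wide _ d) ?(leq_trans (size_Poly _)) ?sr //.
by apply: eq_bigr => i _; rewrite coef_Poly.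
Qed.

Let V1 : V 1.
Proof. by rewrite -(rmorph1 iota); apply/V_iota; apply: (val_ge0_1 pp HF). Qed.
Let V0 : V 0. Proof. by rewrite -(subrr 1); apply: V_sub. Qed.
Let VN x : V x -> V (- x).
Proof. by move=> Vx; rewrite -sub0r; apply: V_sub. Qed.
Let VD x y : V x -> V y -> V (x + y).
Proof. by move=> Vx Vy; rewrite -[y]opprK; apply: V_sub => //; apply: VN. Qed.
Let Vnat n : V n%:R.
Proof. by elim: n => // n IH; rewrite -natr1; apply: VD. Qed.
Let VX x n : V x -> V (x ^+ n).
Proof. by move=> Vx; elim: n => [|n IH]; rewrite ?expr0 // exprS; apply: V_mul. Qed.
Let VpX n : V (p%:R ^+ n). Proof. by apply: VX. Qed.

Lemma K_p_neq0 : p%:R != 0 :> K.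
Proof. by rewrite -(rmorph_nat iota) fmorph_eq0; apply: (Qp_p_neq0 pp HF). Qed.

Let pX0 n : p%:R ^+ n != 0 :> K. Proof. by rewrite expf_neq0 ?K_p_neq0. Qed.

(* The coarsening of the [p]-adic valuation of [K] by its standard convex subgroup [Z]:
   its residue field has characteristic 0. *)
Definition coarse_ring (x : K) := exists n, V (p%:R ^+ n * x).
Definition coarse_ideal (x : K) := forall n, V (x / p%:R ^+ n).
Local Notation O := coarse_ring.
Local Notation m := coarse_ideal.

Lemma coarse_ideal_V x : m x -> V x.
Proof. by move=> /(_ 0%N); rewrite expr0 divr1. Qed.

Lemma coarse_ring_iota x : O (iota x).
Proof.
have [n Hn] := val_ge0_scale pp HF x; exists n.
by rewrite -(rmorph_nat iota) -rmorphXn -rmorphM; apply/V_iota.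
Qed.

Lemma coarse_ideal_iota x : m (iota x) -> x = 0.
Proof.
move=> mx; apply: (val_ge_all0 pp HF) => n; apply/(val_geVp pp HF)/V_iota.
by rewrite rmorphM fmorphV rmorphXn rmorph_nat; apply: mx.
Qed.

Lemma coarse_henselian : henselian_char0 O m.
Proof.
have mM x y : O x -> m y -> m (x * y).
  move=> [n Hn] my k; have -> : x * y / p%:R ^+ k = p%:R ^+ n * x * (y / p%:R ^+ (n + k)).
    by rewrite exprD; field; rewrite !pX0.
  exact: V_mul.
have mO x : m x -> O x by move=> /coarse_ideal_V; exists 0%N; rewrite expr0 mul1r.
have mD x y : m x -> m y -> m (x + y).
  by move=> mx my n; rewrite mulrDl; apply: VD.
have OM x y : O x -> O y -> O (x * y).
  by move=> [n Hn] [k Hk]; exists (n + k)%N; rewrite exprD mulrACA; apply: V_mul.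
have OVm x : x != 0 -> O x \/ m x^-1.
  move=> x0; have [|nO] := pselect (O x); [by left | right => n].
  have y0 : p%:R ^+ n * x != 0 by rewrite mulf_neq0.
  case: (V_total y0) => [Vy|]; first by case: nO; exists n.
  move/(V_mul (Vnat p)); rewrite mulrC divfK ?K_p_neq0 // invfM mulrC //.
have nm1 : ~ m 1.
  by rewrite -(rmorph1 iota) => /coarse_ideal_iota /eqP; rewrite oner_eq0.
split=> //.
- by exists 0%N; rewrite expr0 mul1r.
- move=> x y [n Hn] [k Hk]; exists (n + k)%N.
  have -> : p%:R ^+ (n + k) * (x - y) = p%:R ^+ k * (p%:R ^+ n * x) - p%:R ^+ n * (p%:R ^+ k * y).
    by rewrite exprD; ring.
  by apply: V_sub; apply: V_mul.
- by move=> n; rewrite mul0r.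
- by move=> n; rewrite -(rmorph_nat iota) fmorph_eq0; apply: (Qp_natr HF).
- by move=> n; rewrite -(rmorph_nat iota) -fmorphV; apply: coarse_ring_iota.
move=> f fO f0 f1.
have f1n : f`_1 != 0.
  apply/eqP=> E; apply: f1; rewrite E => n; rewrite mul0r //.
have Of1V : O (f`_1)^-1.
  by case: (OVm _ (invr_neq0 f1n)) => //; rewrite invrK.
have [f00|f00] := eqVneq f`_0 0.
  by exists 0; [move=> n; rewrite mul0r | rewrite horner_coef0].
(* Substituting a s for the variable and dividing by the constant coefficient turns the equation
   into the normal form with linear part 1 + s. The coefficient of index i >= 2 contains a^(i-1), so
   it lies in [m], hence in p V. *)
pose a := f`_0 / f`_1; have a0 : a != 0 by rewrite mulf_neq0 ?invr_neq0.
have ma : m a by rewrite /a mulrC; apply: mM.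
have aO n : O (a ^+ n).
  elim: n => [|n IH]; first by exists 0%N; rewrite !expr0 mul1r.
  by rewrite exprS; apply: OM => //; apply: mO.
pose d := size f; have [r sr rE] : exists2 r : seq K, size r = d.+2 &
    forall i, (i < d.+2)%N -> r`_i = if (i < 2)%N then 0 else f`_i * a ^+ i / f`_0.
  exists (mkseq (fun i => if (i < 2)%N then 0 else f`_i * a ^+ i / f`_0) d.+2).
    by rewrite size_mkseq.
  by move=> i id; rewrite nth_mkseq.
have [i|s [Vs]] := @V_hensel r.
  rewrite sr => id; rewrite rE //; case: i id => [|[|i]] _ /=; rewrite ?mul0r //.
  rewrite -[p%:R]expr1; suff : m (f`_i.+2 * a ^+ i.+2 / f`_0) by apply.
  have -> : f`_i.+2 * a ^+ i.+2 / f`_0 = (f`_i.+2 * a ^+ i * (f`_1)^-1) * a.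
    by rewrite !exprS /a; field; rewrite f00 f1n.
  exact: (mM _ _ (OM _ _ (OM _ _ (fO _) (aO _)) Of1V) ma).
rewrite sr !big_ord_recl /= (rE 0%N) // (rE (bump 0 0)) //= !mul0r !add0r => E.
exists (a * s); first by rewrite mulrC; apply: mM => //; exists 0%N; rewrite expr0 mul1r.
suff -> : f.[a * s] = f`_0 * (1 + s + \sum_(i < d) r`_i.+2 * s ^+ i.+2).
  suff -> : 1 + s + \sum_(i < d) r`_i.+2 * s ^+ i.+2 = 0 by rewrite mulr0.
  exact: E.
rewrite (@horner_coef_wide _ d.+2) ?leqW // !big_ord_recl /= expr0 expr1 mulr1 /bump /=.
rewrite addrA !mulrDr mulr1 -addrA -[in RHS]addrA; congr (_ + (_ + _)).
  by rewrite /a; field; rewrite f1n.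
rewrite mulr_sumr; apply: eq_bigr => i _; rewrite !add1n rE ?ltnS //= exprMn.
by field; rewrite f00.
Qed.

Let HO := coarse_henselian.

(** * Invariance of formulas under the equivalence of tuples *)

(** Definable approximations of [approx]: a/b lies in 1 + p^n V. Zero is treated apart because the
    inverse of 0 is 0, which would make the condition hold for every [a] when [b] is zero. *)
Definition close n (a b : K) :=
  (a = 0 /\ b = 0) \/ (b <> 0 /\ V ((a - b) / (p%:R ^+ n * b))).

Lemma closeP a b : (forall n, close n a b) <-> approx m a b.
Proof.
split=> [H|ab n].
  have [b0|b0] := eqVneq b 0.
    by case: (H 0%N) => [[-> ->]|[]//]; apply: (approx_refl HO).
  exists ((a - b) / b); last by rewrite divfK.
  move=> n; case: (H n) => [[_ /eqP]|[_]]; first by rewrite (negPf b0).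
  by rewrite invfM mulrAC mulrA.
have [b0|b0] := eqVneq b 0; first by left; split=> //; apply/(approx_eq0 HO ab).
right; split; first exact/eqP.
by have [x mx ->] := ab; rewrite invfM mulrACA divff // mulr1; apply: mx.
Qed.

Definition close_formula n M (t1 t2 : GRing.term F) : GRing.formula F :=
  let zero := GRing.NatConst F 0 in
  GRing.Or (GRing.And (GRing.Equal t1 zero) (GRing.Equal t2 zero))
    (GRing.And (GRing.Not (GRing.Equal t2 zero))
       (valF phi M (GRing.Mul (GRing.Add t1 (GRing.Opp t2))
          (GRing.Inv (GRing.Mul (GRing.Exp (GRing.NatConst F p) n) t2))))).

Lemma holds_close_formula e n M t1 t2 : tlt M t1 -> tlt M t2 ->
  GRing.holds e (close_formula n M t1 t2)^K <->
  close n (GRing.eval e t1^t) (GRing.eval e t2^t).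
Proof. by move=> l1 l2; rewrite /= holds_valF_K //= l1 l2. Qed.

Definition equiv_env (e e' : seq K) := exists G, [/\ good m G,
  forall a, G (iota a) (iota a) & forall i, G e`_i e'`_i].

Lemma equiv_env_sym e e' : equiv_env e e' -> equiv_env e' e.
Proof.
move=> [G [gG Gd Ge]]; exists (fun a b => G b a); split=> //; split.
- exact: (good1 gG).
- by move=> a b c d; apply: (goodB gG).
- by move=> a b c d; apply: (goodM gG).
- by move=> a b /(good_approx gG); apply: (approx_sym HO).
Qed.

Lemma equiv_env_maximal e e' : equiv_env e e' -> exists G, [/\ maximal_good m G,
  forall a, G (iota a) (iota a) & forall i, G e`_i e'`_i].
Proof.
move=> [G0 [g0 G0d G0e]]; have [G mG sub] := maximal_good_exists g0.
by exists G; split=> // i; apply: sub.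
Qed.

(** The values of inverse-free terms at [e] and [e'] form a good relation. So equivalence is a set
    of conditions [close] on terms, to which saturation applies. *)
Lemma equiv_env_terms e e' :
  (forall t : GRing.term F, GRing.rterm t ->
     approx m (GRing.eval e' t^t) (GRing.eval e t^t)) -> equiv_env e e'.
Proof.
move=> H; exists (fun a b => exists t : GRing.term F,
  [/\ GRing.rterm t, a = GRing.eval e t^t & b = GRing.eval e' t^t]); split.
- split.
  + by exists (GRing.NatConst F 1).
  + move=> _ _ _ _ [t [rt -> ->]] [u [ru -> ->]]; exists (GRing.Add t (GRing.Opp u)).
    by rewrite /= rt ru.
  + move=> _ _ _ _ [t [rt -> ->]] [u [ru -> ->]]; exists (GRing.Mul t u).
    by rewrite /= rt ru.
  + by move=> _ _ [t [rt -> ->]]; apply: H.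
- by move=> a; exists (GRing.Const a).
- by move=> i; exists (GRing.Var F i).
Qed.

Lemma term_polyrel G e e' i (t : GRing.term F) : good m G ->
  (forall a, G (iota a) (iota a)) -> (forall j, G e`_j e'`_j) -> GRing.rterm t ->
  exists P P', [/\ polyrel G P P', forall y, GRing.eval (set_nth 0 e i y) t^t = P.[y]
    & forall y, GRing.eval (set_nth 0 e' i y) t^t = P'.[y]].
Proof.
move=> gG Gd Ge; elim: t => //=.
- move=> j _; have [ji|ji] := eqVneq j i.
    exists 'X, 'X; split; first exact: (polyrelX gG).
      by move=> y; rewrite nth_set_nth /= ji eqxx hornerX.
    by move=> y; rewrite nth_set_nth /= ji eqxx hornerX.
  exists (e`_j)%:P, (e'`_j)%:P; split; first exact: (polyrelC gG).
    by move=> y; rewrite nth_set_nth /= (negPf ji) hornerC.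
  by move=> y; rewrite nth_set_nth /= (negPf ji) hornerC.
- move=> a _; exists (iota a)%:P, (iota a)%:P; split; first exact: (polyrelC gG).
    by move=> y; rewrite hornerC.
  by move=> y; rewrite hornerC.
- move=> n _; exists (n%:R)%:P, (n%:R)%:P; split.
  + by apply: (polyrelC gG); apply: (goodMn gG); apply: (good1 gG).
  + by move=> y; rewrite hornerC.
  + by move=> y; rewrite hornerC.
- move=> t1 I1 t2 I2 /andP[/I1 [P1 [P1' [r1 E1 E1']]] /I2 [P2 [P2' [r2 E2 E2']]]].
  exists (P1 + P2), (P1' + P2'); split; first exact: (polyrelD gG).
    by move=> y; rewrite hornerD E1 E2.
  by move=> y; rewrite hornerD E1' E2'.
- move=> t1 I1 /I1 [P1 [P1' [r1 E1 E1']]].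
  exists (- P1), (- P1'); split; first exact: (polyrelN gG).
    by move=> y; rewrite hornerN E1.
  by move=> y; rewrite hornerN E1'.
- move=> t1 I1 n /I1 [P1 [P1' [r1 E1 E1']]].
  exists (P1 *+ n), (P1' *+ n); split; first exact: (polyrelMn gG).
    by move=> y; rewrite hornerMn E1.
  by move=> y; rewrite hornerMn E1'.
- move=> t1 I1 t2 I2 /andP[/I1 [P1 [P1' [r1 E1 E1']]] /I2 [P2 [P2' [r2 E2 E2']]]].
  exists (P1 * P2), (P1' * P2'); split; first exact: (polyrelM gG).
    by move=> y; rewrite hornerM E1 E2.
  by move=> y; rewrite hornerM E1' E2'.
- move=> t1 I1 n /I1 [P1 [P1' [r1 E1 E1']]].
  exists (P1 ^+ n), (P1' ^+ n); split; first exact: (polyrel_exp gG).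
    by move=> y; rewrite horner_exp E1.
  by move=> y; rewrite horner_exp E1'.
Qed.

Lemma iota_small : small (fun x : K => exists a, x = iota a).
Proof.
have [g Hg] := Qp_small pp HF.
have [h Hh] : exists h : K -> F, forall a, h (iota a) = a.
  exists (fun x => if pselect (exists a, x = iota a) is left H then projT1 (cid H) else 0).
  move=> a; case: pselect => [H|[]]; last by exists a.
  by case: (cid H) => b /= /fmorph_inj.
exists (g \o h) => _ _ [a ->] [b ->] /=; rewrite !Hh => /Hg -> //.
Qed.

(** The sought [y] must satisfy a condition [close] for each term and each precision. Finitely many
    of them concern finitely many polynomials in the new variable, and [maximal_good_extend] solves
    these. *)
Lemma back_and_forth e e' i x : equiv_env e e' ->
  exists y, equiv_env (set_nth 0 e i x) (set_nth 0 e' i y).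
Proof.
move/equiv_env_maximal => [G [mG Gd Ge]].
pose k := maxn (maxn (size e) (size e')) i.+1.
pose ex := set_nth 0 e i x.
pose e0 := mkseq (nth 0 ex) k ++ mkseq (nth 0 e') k.
have s0 : size e0 = (k + k)%N by rewrite size_cat !size_mkseq.
have ik : (i < k)%N by rewrite leq_max ltnSn orbT.
(* The first block of [e0] holds the tuple containing [x] and the second block holds [e']; the
   unknown [y] is variable k + k and replaces the entry [i] of the second block. *)
pose r1 j := if j == i then GRing.Var F (k + k) else shift_var F k k j.
pose r2 j := shift_var F k 0 j.
pose M := (k + k).+1.
have r1M j : tlt M (r1 j).
  by rewrite /r1; case: ifP => /= _; rewrite ?ltnSn //; apply: tlt_shift_var; rewrite /M.
have r2M j : tlt M (r2 j).
  by apply: tlt_shift_var; rewrite add0n /M ltnW // ltnS leq_addr.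
have E1 y t : GRing.eval (e0 ++ [:: y]) (tsub r1 t)^t = GRing.eval (set_nth 0 e' i y) t^t.
  rewrite tsub_map; apply: eval_tsub => j; rewrite /r1 nth_set_nth /=; case: eqP => _.
    by rewrite /= nth_cat s0 ltnn subnn.
  rewrite shift_var_map /e0 -catA (eval_shift_var _ _ (size_mkseq _ _) (size_mkseq _ _)).
  have [jk|jk] := ltnP j k; first by rewrite nth_mkseq.
  by rewrite !nth_default ?size_mkseq // (leq_trans _ jk) // /k !leq_max leqnn orbT.
have E2 y t : GRing.eval (e0 ++ [:: y]) (tsub r2 t)^t = GRing.eval ex t^t.
  rewrite tsub_map; apply: eval_tsub => j; rewrite /r2 shift_var_map /e0 -catA.
  rewrite (@eval_shift_var _ [::]) ?size_mkseq //.
  have [jk|jk] := ltnP j k; first by rewrite nth_mkseq.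
  rewrite !nth_default ?size_mkseq // size_set_nth (leq_trans _ jk) // geq_max ik /=.
  by rewrite /k !leq_max leqnn.
pose Phi (tn : GRing.term F * nat) := if GRing.rterm tn.1 then
  close_formula tn.2 M (tsub r1 tn.1) (tsub r2 tn.1) else GRing.Bool true.
have PhiE y tn : GRing.holds (e0 ++ [:: y]) (Phi tn)^K <-> (GRing.rterm tn.1 ->
    close tn.2 (GRing.eval (set_nth 0 e' i y) tn.1^t) (GRing.eval ex tn.1^t)).
  rewrite /Phi; case: ifP => [rt|rt] //.
  rewrite holds_close_formula; [|exact: tlt_tsub|exact: tlt_tsub].
  by rewrite E1 E2; split=> [//|]; apply.
have [s|r [sr Hr]] := @saturated_multi F K iota _ Phi 1 e0 Hsat iota_small.
  have [L [HL Ls]] : exists L : seq ({poly K} * {poly K}),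
      (forall QQ, QQ \in L -> polyrel G QQ.1 QQ.2) /\
      (forall tn, inL tn s -> GRing.rterm tn.1 -> exists2 QQ, QQ \in L &
         (GRing.eval ex tn.1^t = QQ.1.[x] /\
          forall y, GRing.eval (set_nth 0 e' i y) tn.1^t = QQ.2.[y])).
    elim: s => [|tn s [L [HL Ls]]]; first by exists [::].
    have [rt|nrt] := boolP (GRing.rterm tn.1); last first.
      exists L; split=> // tn' [<-|/Ls//]; by rewrite (negPf nrt).
    have [P [P' [rP EP EP']]] := term_polyrel i mG.1 Gd Ge rt.
    exists ((P, P') :: L); split.
      by move=> QQ; rewrite inE => /orP[/eqP->|/HL].
    move=> tn' [<- _|ts rt'].
      by exists (P, P'); [rewrite inE eqxx | split; [apply: EP | apply: EP']].
    by have [QQ QL E] := Ls _ ts rt'; exists QQ; rewrite // inE QL orbT.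
  have [y Hy] := maximal_good_extend HO mG x HL.
  exists [:: y]; split=> // tn ts; apply/PhiE => rt.
  have [QQ QL [-> ->]] := Ls _ ts rt.
  by have /closeP := Hy _ QL; apply.
case: r sr Hr => [|y [|]] // _ Hr; exists y.
apply: equiv_env_terms => t rt; apply/closeP => n.
by have /PhiE := Hr (t, n); apply.
Qed.

(** Quantifiers are handled by [back_and_forth]. Atomic formulas may contain inverses, so the
    relation is first enlarged to a maximal one, whose domain is a field. *)
Theorem equiv_env_holds (f : GRing.formula F) e e' : equiv_env e e' ->
  GRing.holds e f^K <-> GRing.holds e' f^K.
Proof.
have evalG G (t : GRing.term F) e1 e2 : maximal_good m G -> (forall a, G (iota a) (iota a)) ->
    (forall j, G e1`_j e2`_j) -> G (GRing.eval e1 t^t) (GRing.eval e2 t^t).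
  move=> mG Gd Ge; have gG := mG.1; elim: t => //=.
  - by move=> n; apply: (goodMn gG); apply: (good1 gG).
  - by move=> *; apply: (goodD gG).
  - by move=> *; apply: (goodN gG).
  - by move=> *; apply: (goodMn gG).
  - by move=> *; apply: (goodM gG).
  - by move=> *; apply: (maximal_goodV HO mG).
  - by move=> *; apply: (goodX gG).
elim: f e e' => //=.
- move=> t1 t2 e e' /equiv_env_maximal [G [mG Gd Ge]].
  have /(good_eq0 HO mG.1) := goodB mG.1 (evalG _ t1 _ _ mG Gd Ge) (evalG _ t2 _ _ mG Gd Ge).
  by rewrite !subr_eq0 => E; split=> /eqP; [rewrite E|rewrite -E] => /eqP.
- move=> t e e' /equiv_env_maximal [G [mG Gd Ge]].
  by rewrite !unitfE (good_eq0 HO mG.1 (evalG _ t _ _ mG Gd Ge)).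
- by move=> f1 I1 f2 I2 e e' H; rewrite (I1 _ _ H) (I2 _ _ H).
- by move=> f1 I1 f2 I2 e e' H; rewrite (I1 _ _ H) (I2 _ _ H).
- by move=> f1 I1 f2 I2 e e' H; rewrite (I1 _ _ H) (I2 _ _ H).
- by move=> f1 I1 e e' H; rewrite (I1 _ _ H).
- move=> i f1 I1 e e' H; split=> -[x Hx].
    by have [y Hy] := back_and_forth i x H; exists y; apply/(I1 _ _ Hy).
  have [y Hy] := back_and_forth i x (equiv_env_sym H).
  by exists y; apply/(I1 _ _ Hy).
- move=> i f1 I1 e e' H; split=> Hx x.
    have [y Hy] := back_and_forth i x (equiv_env_sym H).
    by apply/(I1 _ _ Hy).
  by have [y Hy] := back_and_forth i x H; apply/(I1 _ _ Hy).
Qed.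


(** If no finite list worked, saturation would produce two equivalent tuples with [f] true at the
    first and false at the second. *)
Lemma finite_invariant (f : GRing.formula F) n : exists L : seq (GRing.term F * nat),
  forall al be : seq K, size al = n -> size be = n ->
  (forall tk, inL tk L -> GRing.rterm tk.1 ->
     close tk.2 (GRing.eval be tk.1^t) (GRing.eval al tk.1^t)) ->
  GRing.holds al f^K -> GRing.holds be f^K.
Proof.
apply: contrapT => noL; pose M := (n + n)%N.
pose rA := shift_var F n 0; pose rB := shift_var F n n.
have rAM j : tlt M (rA j) by apply: tlt_shift_var; rewrite add0n leq_addr.
have rBM j : tlt M (rB j) by apply: tlt_shift_var.
pose Phi (tk : GRing.term F * nat) := GRing.And (if GRing.rterm tk.1 then
    close_formula tk.2 M (tsub rB tk.1) (tsub rA tk.1) else GRing.Bool true)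
  (GRing.And (fsub M rA f) (GRing.Not (fsub M rB f))).
have PhiE al be tk : size al = n -> size be = n -> GRing.holds (al ++ be) (Phi tk)^K <->
    (GRing.rterm tk.1 -> close tk.2 (GRing.eval be tk.1^t) (GRing.eval al tk.1^t)) /\
    (GRing.holds al f^K /\ ~ GRing.holds be f^K).
  move=> sal sbe.
  have EA j : GRing.eval (al ++ be) (rA j)^t = al`_j.
    by rewrite shift_var_map; apply: (@eval_shift_var _ [::]).
  have EB j : GRing.eval (al ++ be) (rB j)^t = be`_j.
    by rewrite shift_var_map -[be]cats0 eval_shift_var // cats0.
  rewrite /= !fsub_map (holds_fsub _ _ EA) ?(holds_fsub _ _ EB); last 2 first.
  - by move=> j; rewrite tlt_map.
  - by move=> j; rewrite tlt_map.
  case: ifP => rt; last by split=> -[].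
  rewrite holds_close_formula; [|exact: tlt_tsub|exact: tlt_tsub].
  rewrite !tsub_map (eval_tsub _ EA) (eval_tsub _ EB).
  by split=> -[H1 H2]; split=> //; apply: H1.
have split_r (r : seq K) : size r = M -> [/\ size (take n r) = n, size (drop n r) = n
    & r = take n r ++ drop n r].
  by move=> sr; rewrite cat_take_drop size_takel ?size_drop sr /M ?addnK ?leq_addr.
have [s|r [/split_r [sA sB rE] Hr]] := @saturated_multi F K iota _ Phi M [::] Hsat iota_small.
  apply: contrapT => nr; apply: noL; exists s => al be sal sbe H Hal.
  apply: contrapT => Hbe; apply: nr; exists (al ++ be); split.
    by rewrite size_cat sal sbe.
  by move=> tk ts; apply/(PhiE al be) => //; split=> //; apply: H.
have {}Hr tk : GRing.holds (take n r ++ drop n r) (Phi tk)^K by rewrite -rE; apply: Hr.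
(* Every [Phi] also asserts [f] at the first tuple and its negation at the second; the pair made of
   the term 0 and precision 0 is used to extract this. *)
have [|_] := iffLR (PhiE _ _ (GRing.NatConst F 0, 0%N) sA sB); first exact: Hr.
case=> HA; apply; suff Eq : equiv_env (take n r) (drop n r) by apply/(equiv_env_holds f Eq).
apply: equiv_env_terms => t rt; apply/closeP => k.
by have [H _] := iffLR (PhiE _ _ (t, k) sA sB) (Hr _); apply: H.
Qed.

(** * Infinitesimals and the trace definition *)

(** A large power of p satisfies any finite number of the conditions. *)
Lemma infinitesimal_exists : exists2 c : K, c != 0 & m c.
Proof.
pose Phi k := GRing.And (GRing.Not (GRing.Equal X0 (GRing.NatConst F 0)))
  (valF phi 1 (GRing.Mul X0 (GRing.Inv (GRing.Exp (GRing.NatConst F p) k)))).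
have [s|r [sr Hr]] := @saturated_multi F K iota _ Phi 1 [::] Hsat iota_small; last first.
  case: r sr Hr => [|c [|]] // _ Hr; exists c.
    by apply/eqP; have [] := Hr 0%N.
  by move=> k; have [_ /holds_valF_K] := Hr k; apply.
have [k Hk] : exists k, forall j, inL j s -> (j <= k)%N.
  elim: s => [|j s [k Hk]]; first by exists 0%N.
  exists (maxn j k) => i [<-|/Hk ik]; first exact: leq_maxl.
  by rewrite leq_max ik orbT.
exists [:: p%:R ^+ k]; split=> // j /Hk jk; split; first by apply/eqP; apply: pX0.
apply/holds_valF_K => //=; rewrite -(subnK jk) exprD mulfK ?pX0 //.
Qed.

Lemma eval_term_map (e : seq F) (t : GRing.term F) :
  GRing.eval (map iota e) t^t = iota (GRing.eval e t).
Proof.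
elim: t => //=.
- move=> i; have [ie|ie] := ltnP i (size e); first exact: nth_map.
  by rewrite (nth_default _ ie) nth_default ?size_map // rmorph0.
- by move=> n; rewrite rmorph_nat.
- by move=> t1 -> t2 ->; rewrite rmorphD.
- by move=> t1 ->; rewrite rmorphN.
- by move=> t1 -> n; rewrite rmorphMn.
- by move=> t1 -> t2 ->; rewrite rmorphM.
- by move=> t1 ->; rewrite fmorphV.
- by move=> t1 -> n; rewrite rmorphXn.
Qed.

(** Q_p lies in [O], so sums and products with standard factors respect congruence modulo [m].
    Inverses do not, near 0, whence the restriction to [rterm]. *)
Lemma near_standard (a : seq F) (al : seq K) (t : GRing.term F) :
  (forall j, m (al`_j - iota a`_j)) -> GRing.rterm t ->
  m (GRing.eval al t^t - iota (GRing.eval a t)).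
Proof.
move=> H; have mD := valmD HO; have mM := valmM HO; have m0 := valm0 HO.
have mM2 x y a1 b1 : m (x - iota a1) -> m (y - iota b1) -> m (x * y - iota (a1 * b1)).
  move=> mx my; rewrite rmorphM.
  have -> : x * y - iota a1 * iota b1 = iota a1 * (y - iota b1) + (iota b1 + (y - iota b1)) * (x - iota a1).
    by ring.
  apply: (mD); apply: (mM) => //; first exact: coarse_ring_iota.
  by apply: (valOD HO); [apply: coarse_ring_iota | apply: (valmO HO)].
elim: t => //=.
- by move=> b _; rewrite subrr.
- by move=> n _; rewrite rmorph_nat subrr.
- move=> t1 I1 t2 I2 /andP[/I1 H1 /I2 H2]; rewrite rmorphD opprD addrACA.
  exact: mD.
- by move=> t1 I1 /I1 H1; rewrite rmorphN -opprD; apply: (valmN HO).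
- move=> t1 I1 n /I1 H1; rewrite rmorphMn -mulrnBl.
  by elim: n => [|n IHn]; rewrite ?mulr0n // mulrS; apply: (mD).
- by move=> t1 I1 t2 I2 /andP[/I1 H1 /I2 H2]; apply: mM2.
- move=> t1 I1 n /I1 H1; elim: n => [|n IHn]; first by rewrite !expr0 rmorph1 subrr.
  by rewrite !exprS; apply: mM2.
Qed.

Lemma nth_ball_env (I : finType) (a c : I -> K) i : 
  (ball_env a c)`_(index i (enum I)).*2 = a i /\ (ball_env a c)`_(index i (enum I)).*2.+1 = c i.
Proof.
rewrite /ball_env; have : i \in enum I by rewrite mem_enum.
by elim: (enum I) => //= j s IH; rewrite inE; case: eqVneq => [->|ij] //= /IH [].
Qed.

Lemma size_ball_env (I : finType) (a c : I -> K) : size (ball_env a c) = #|I|.*2.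
Proof. by rewrite /ball_env cardE; elim: (enum I) => //= i s ->. Qed.

Lemma mem_ball (a c x : K) : c != 0 -> ball V a c x <-> V ((x - a) / c).
Proof.
move=> c0; split=> [[d [Vd ->]]|Vd]; first by rewrite addrAC subrr add0r mulrAC divff ?mul1r.
by exists ((x - a) / c); split=> //; rewrite mulrC divfK // addrC subrK.
Qed.

Section TraceSet.
Variables (n : nat) (f : GRing.formula F) (L : seq (GRing.term F * nat)) (c : K).
Local Notation I := ('I_n * 'I_1)%type.

Definition in_balls (b : I -> Ball V) (al : seq K) :=
  size al = n /\ forall i : 'I_n, proj1_sig (b (i, ord0)) (c * al`_i).

Definition trace_set (b : I -> Ball V) := exists al, [/\ in_balls b al, GRing.holds al f^K &
  forall tk, inL tk L -> GRing.rterm tk.1 -> GRing.eval al tk.1^t = 0 \/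
    ~ exists al', in_balls b al' /\ GRing.eval al' tk.1^t = 0].

(** Membership of c y in a ball reads V((c y - a) / r) for any center [a] and radius element [r] of
    that ball, so the formula does not depend on the representatives. *)
Lemma trace_set_definable : B_definable trace_set.
Proof.
(* Variables come in three blocks: the [d] entries describing the balls, then the tuple [al], then
   the competing tuple [al']. The ball of index [i] has its center at [idx i] and its radius element
   just after. *)
pose d := #|{: I}|.*2; pose M := (d + n + n)%N.
pose var i := GRing.Var K i.
pose idx (i : 'I_n) := (index (i, ord0 : 'I_1) (enum {: I})).*2.
have idxd i : ((idx i).+1 < d)%N.
  by rewrite /idx /d -doubleS leq_double cardE index_mem mem_enum.
pose inb k (i : 'I_n) := valF phi^K M (GRing.Mul
  (GRing.Add (GRing.Mul (GRing.Const c) (var (k + i)%N)) (GRing.Opp (var (idx i))))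
  (GRing.Inv (var (idx i).+1))).
pose zero (t : GRing.term F) k := GRing.Equal (tsub (shift_var K n k) t^t) (GRing.NatConst K 0).
pose cnd (tk : GRing.term F * nat) := if GRing.rterm tk.1 then GRing.Or (zero tk.1 d)
    (GRing.Not (exq (d + n) n (GRing.And (fconj (inb (d + n)%N) (enum 'I_n)) (zero tk.1 (d + n)%N))))
  else GRing.Bool true.
exists (exq d n (GRing.And (fconj (inb d) (enum 'I_n))
  (GRing.And (fsub M (shift_var K n d) f^K) (fconj cnd L)))).
move=> a r b Hb; set e := ball_env a r.
have se : size e = d by apply: size_ball_env.
have inbE k e1 al e2 : size e1 = k -> (k + n <= M)%N -> (forall j, (j < d)%N -> e1`_j = e`_j) ->
    (d <= k)%N -> size al = n ->
    GRing.holds (e1 ++ al ++ e2) (fconj (inb k) (enum 'I_n)) <-> in_balls b al.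
  move=> s1 kM E1 dk sal.
  have inb1 (i : 'I_n) : GRing.holds (e1 ++ al ++ e2) (inb k i) <->
      proj1_sig (b (i, ord0)) (c * al`_i).
    have id1 := idxd i; have id0 := ltnW id1.
    have [_ _ r0 ->] := Hb (i, ord0); have [Ea Er] := nth_ball_env a r (i, ord0 : 'I_1).
    rewrite holds_valF /=; last first.
      rewrite (leq_trans _ kM) ?ltn_add2l //= !(leq_trans _ (leq_trans (leq_addr n k) kM)) //.
        exact: leq_trans dk.
      exact: leq_trans dk.
    rewrite !nth_cat s1 addKn sal ltn_ord ltnNge leq_addr /= !(leq_trans _ dk) // !E1 //.
    by rewrite -/e in Ea Er; rewrite Ea Er mem_ball.
  split=> [/holds_fconj H|[_ H]].
    by split=> // i; apply/inb1/H/inLP; rewrite mem_enum.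
  by apply/holds_fconj => i _; apply/inb1.
have zeroE k e1 al e2 t : size e1 = k -> size al = n ->
    GRing.holds (e1 ++ al ++ e2) (zero t k) <-> GRing.eval al t^t = 0.
  move=> s1 sal; rewrite /zero /=.
  by rewrite (@eval_tsub _ _ _ al) // => j; apply: eval_shift_var.
have HEx (e1 : seq K) g k : size e1 = k -> GRing.holds e1 (exq k n g) <->
    exists al, size al = n /\ GRing.holds (e1 ++ al) g.
  by move=> <-; apply: holds_exq.
have cndE al : size al = n -> GRing.holds (e ++ al) (fconj cnd L) <->
    forall tk, inL tk L -> GRing.rterm tk.1 -> GRing.eval al tk.1^t = 0 \/
      ~ exists al', in_balls b al' /\ GRing.eval al' tk.1^t = 0.
  move=> sal; rewrite holds_fconj.
  have sea : size (e ++ al) = (d + n)%N by rewrite size_cat se sal.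
  have one tk : GRing.holds (e ++ al) (cnd tk) <-> (GRing.rterm tk.1 -> GRing.eval al tk.1^t = 0 \/
      ~ exists al', in_balls b al' /\ GRing.eval al' tk.1^t = 0).
    rewrite /cnd; case: ifP => // rt /=; rewrite (HEx _ _ _ sea).
    have -> : GRing.eval (e ++ al) (tsub (shift_var K n d) tk.1^t) = GRing.eval al tk.1^t.
      by apply: eval_tsub => j; rewrite -[al]cats0 eval_shift_var // cats0.
    have -> : (exists al', size al' = n /\ (GRing.holds ((e ++ al) ++ al')
        (fconj (inb (d + n)%N) (enum 'I_n)) /\ GRing.eval ((e ++ al) ++ al')
        (tsub (shift_var K n (d + n)) tk.1^t) = 0)) <->
        exists al', in_balls b al' /\ GRing.eval al' tk.1^t = 0.
      have step al' : size al' = n -> (GRing.holds ((e ++ al) ++ al')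
          (fconj (inb (d + n)%N) (enum 'I_n)) /\ GRing.eval ((e ++ al) ++ al')
          (tsub (shift_var K n (d + n)) tk.1^t) = 0) <->
          in_balls b al' /\ GRing.eval al' tk.1^t = 0.
        move=> sal'; have Z := zeroE (d + n)%N (e ++ al) al' [::] tk.1 sea sal'.
        have B : GRing.holds ((e ++ al) ++ al' ++ [::]) (fconj (inb (d + n)%N) (enum 'I_n)) <->
            in_balls b al'.
          apply: inbE => //; last exact: leq_addr.
          by move=> j jd; rewrite nth_cat se jd.
        by move: Z B; rewrite /zero /= cats0 => -> ->.
      split=> [[al' [sal' /step]]|[al' [H E]]]; first by move=> /(_ sal'); exists al'.
      by exists al'; split; [case: H | apply/step => //; case: H].
    by split=> [//|]; apply.
  by split=> H tk tL; apply/one/H.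
rewrite (HEx _ _ _ se); split=> [[al [[sal Hal] Hf Hc]]|[al [sal [/= H1 [H2 H3]]]]].
  exists al; split=> //=; split; last split; last exact/cndE.
    by rewrite -[al]cats0; apply/inbE => //; rewrite /M leq_addr.
  apply/holds_fsub; last exact: Hf.
    by move=> j; apply: tlt_shift_var; rewrite /M leq_addr.
  by move=> j; rewrite -[al]cats0 eval_shift_var // cats0.
exists al; split; last exact/cndE.
  by rewrite -[al]cats0 in H1; move/inbE: H1; apply => //; rewrite /M leq_addr.
move: H2; apply: iffLR; apply: holds_fsub.
  by move=> j; apply: tlt_shift_var; rewrite /M leq_addr.
by move=> j; rewrite -[al]cats0 eval_shift_var // cats0.
Qed.

End TraceSet.

Theorem trace_definition : ball_trace_defines_field V F.
Proof.
have [c c0 mc] := infinitesimal_exists; have mM := valmM HO.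
have cc0 : c * c != 0 by rewrite mulf_neq0.
have tauP x : exists a d, [/\ V a, V d, d != 0 & ball V (c * iota x) (c * c) = ball V a d].
  exists (c * iota x), (c * c); split=> //.
    by apply: coarse_ideal_V; rewrite mulrC; apply: mM => //; apply: coarse_ring_iota.
  by apply: coarse_ideal_V; apply: mM => //; apply: (valmO HO).
pose tau (x : F) (_ : 'I_1) : Ball V := exist _ _ (tauP x).
have near x y : proj1_sig (tau x ord0) (c * y) -> m (y - iota x).
  have E : (c * y - c * iota x) / (c * c) = (y - iota x) / c by field.
  move/(mem_ball _ _ cc0); rewrite E => Vy.
  have -> : y - iota x = (y - iota x) / c * c by rewrite divfK.
  by apply: mM => //; exists 0%N; rewrite expr0 mul1r.
have self x : proj1_sig (tau x ord0) (c * iota x).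
  by apply/(mem_ball _ _ cc0); rewrite subrr mul0r; apply: V0.
exists 1%N, tau; split.
  move=> x y E; have Eb : tau x ord0 = tau y ord0 by rewrite E.
  have /near : proj1_sig (tau y ord0) (c * iota x) by rewrite -Eb; apply: self.
  by rewrite -rmorphB => /coarse_ideal_iota /eqP; rewrite subr_eq0 => /eqP.
move=> n X [f Hf]; have [L HL] := finite_invariant f n.
exists (trace_set f L c); split; first exact: trace_set_definable.
move=> x; set xs := [seq x i | i <- enum 'I_n].
have sx : size xs = n by rewrite size_map size_enum_ord.
have sxs : size (map iota xs) = n by rewrite size_map.
have xsE (i : 'I_n) : (map iota xs)`_i = iota (x i).
  rewrite (nth_map 0) ?sx // (nth_map i) ?size_enum_ord //.
  by rewrite nth_ord_enum.
have xs_in : in_balls c (fun ij : 'I_n * 'I_1 => tau (x ij.1) ij.2) (map iota xs).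
  by split=> // i; rewrite xsE; apply: self.
have near_in al : in_balls c (fun ij : 'I_n * 'I_1 => tau (x ij.1) ij.2) al ->
    forall j, m (al`_j - iota xs`_j).
  move=> [sal Hal] j; have [jn|jn] := ltnP j n; last first.
    rewrite !nth_default ?sal ?sx // rmorph0 subrr.
    exact: (valm0 HO).
  have := near _ _ (Hal (Ordinal jn)); rewrite /= -xsE /=.
  by rewrite (nth_map 0) // sx.
have zero_in al (t : GRing.term F) : in_balls c (fun ij : 'I_n * 'I_1 => tau (x ij.1) ij.2) al ->
    GRing.rterm t -> GRing.eval al t^t = 0 -> GRing.eval (map iota xs) t^t = 0.
  move=> /near_in Hal rt E; have := near_standard Hal rt; rewrite E sub0r -rmorphN.
  by move/coarse_ideal_iota/eqP; rewrite oppr_eq0 eval_term_map => /eqP ->; rewrite rmorph0.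
rewrite Hf; split=> [/(Hel f) Hx|[al [Hal Hfal Hc]]].
  (* The standard point is its own witness: a polynomial with a zero in the balls already vanishes
     there. *)
  exists (map iota xs); split=> // tk _ rt; have [E|/eqP E] := eqVneq (GRing.eval (map iota xs) tk.1^t) 0.
    by left.
  by right=> -[al' [Hal' E']]; apply: E; apply: zero_in Hal' rt E'.
apply/(Hel f); apply: (HL al) => //; first by case: Hal.
(* If the polynomial vanishes at [al], it vanishes at the standard point too. If it has no zero in
   the balls, its value at the standard point is nonzero. *)
move=> tk tL rt; have [E|E] := Hc _ tL rt; first by left; split=> //; apply: zero_in Hal rt E.
have x0 : GRing.eval xs tk.1 != 0.
  by apply/eqP=> E0; apply: E; exists (map iota xs); rewrite eval_term_map E0 rmorph0.
have /closeP : approx m (GRing.eval (map iota xs) tk.1^t) (GRing.eval al tk.1^t); last by apply.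
apply: (approx_sym HO); rewrite eval_term_map.
(* The relative error is infinitesimal because the inverse of a nonzero standard value is standard,
   hence in [O]. *)
exists ((GRing.eval al tk.1^t - iota (GRing.eval xs tk.1)) * iota (GRing.eval xs tk.1)^-1).
  rewrite mulrC; apply: mM; first exact: coarse_ring_iota.
  by apply: near_standard => //; apply: near_in.
by rewrite fmorphV divfK // fmorph_eq0.
Qed.

End Main.

Theorem theorem1p4 (p : nat) (pp : prime p)
  (F : fieldType) (v : F -> int) (HF : is_Qp p F v)
  (K : fieldType) (iota : {rmorphism F -> K}) (Hel : elementary iota)
  (Hsat : continuum_plus_saturated K)
  (phi : GRing.formula F)
  (Hphi : forall x : F, GRing.holds [:: x] phi <-> (x = 0 \/ 0 <= v x)) :
  ball_trace_defines_field
    (fun y : K => GRing.holds [:: y] (form_map iota phi)) F.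
Proof. exact: (trace_definition pp HF Hel Hsat Hphi). Qed.
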